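(* For every fixed positive integer $d$ there are positive constants $C$ and $c$ depending only on $d$ such that the following holds. Let $A_1,\dots,A_l$ be subsets of $[n]=\{1,\dots,n\}$, each of the same size $|A|$, where $l$ and $|A|$ satisfy $l^d|A|\ge Cn$. Then $A_1+\dots+A_l$ contains a generalized arithmetic progression of rank $d'$ and volume at least $c\,l^{d'}|A|$, for some integer $1\le d'\le d$.
   Context: $A_1+\dots+A_l=\{a_1+\dots+a_l: a_i\in A_i\}$. A generalized arithmetic progression (GAP) of rank $d$ is a set $Q=\{a+\sum_{i=1}^d x_i a_i : 0\le x_i\le n_i \text{ integers}\}$, considered together with its data $a,a_1,\dots,a_d,n_1,\dots,n_d$; its volume is $\prod_{i=1}^d n_i$. *)

(* Defs.v *)
From mathcomp Require Import all_boot all_order all_algebra.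
From mathcomp Require Import finmap.
From mathcomp Require Import boolp classical_sets reals.

Set Implicit Arguments.
Unset Strict Implicit.
Unset Printing Implicit Defensive.

Import Order.TTheory GRing.Theory Num.Theory.

Local Open Scope classical_set_scope.
Local Open Scope ring_scope.

Definition sumset (l : nat) (A : 'I_l -> {fset int}) : set int :=
  [set s | exists a : 'I_l -> int,
     (forall i, a i \in A i) /\ s = \sum_(i < l) a i].

(* The data are kept, not only the underlying set: the rank and the volume
   depend on the presentation. *)
Record gap (r : nat) := Gap {
  gap_base : int;
  gap_step : 'I_r -> int;
  gap_len : 'I_r -> nat }.

Definition gap_set (r : nat) (Q : gap r) : set int :=
  [set s | exists x : 'I_r -> nat,
     (forall i, (x i <= gap_len Q i)%N) /\
     s = gap_base Q + \sum_(i < r) (x i)%:Z * gap_step Q i].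

(* The lengths run over 0 <= x_i <= n_i but the volume is the product of the
   n_i, not of the n_i + 1; it need not be the cardinal of gap_set. *)
Definition gap_volume (r : nat) (Q : gap r) : nat :=
  (\prod_(i < r) gap_len Q i)%N.

(* A zero step lets the volume grow without enlarging gap_set, so that any
   single point carries GAPs of arbitrary volume.  Nondegeneracy is weaker than
   properness: the sums may still coincide. *)
Definition gap_nondegenerate (r : nat) (Q : gap r) : Prop :=
  forall i, gap_step Q i != 0.

(* Main.v *)
Require Import Defs.
From HB Require Import structures.
From mathcomp Require Import all_boot all_order all_algebra.
From mathcomp Require Import finmap.
From mathcomp Require Import boolp classical_sets reals.
From mathcomp Require Import exp trigo.
From mathcomp Require Import zify ring lra.

Set Implicit Arguments.
Unset Strict Implicit.
Unset Printing Implicit Defensive.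

Import Order.TTheory GRing.Theory Num.Theory.

(* Idea.  Steps of a GAP may be repeated, so it is enough to find in the sumset
   an arithmetic progression of length L with L^d >= c l^d |A|.

   Summing the sets in pairs as long as many pairs grow by a factor 4^(d+1)
   leads to m sets X_i of a common size s, with s m^(d+1) >= c |A| l^(d+1), whose
   pairwise sumsets have size O(s).  For one of them, Y, the route of Ruzsa
   (Petridis' inequality, the model lemma, Bogolyubov's lemma and a discrete
   form of Minkowski's second theorem) gives a GAP P in 2Y - 2Y of bounded rank
   with |P| >= c s.

   Every X_i + X_j contains u + F - F with |F| >= c s, and since X_i + P has size
   O(s), each x with x, 2x, ..., Jx in P satisfies qx in F - F for some q <= J,
   where J is a constant.  Collecting equal values of q, a sum of boundedly many
   X_i contains a translate of J! P' for a shrunken copy P' of P.  Hence the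
   whole sumset contains a translate of a dilate, by a factor t of order m, of a
   GAP with about s elements.

   Modulo the integer relations of size about t between the steps, this GAP has
   some dimension r.  If r > d, the dilate has at least c t^(d+1) s elements, too
   many for a subset of [1, l n].  If r <= d, Dirichlet's principle gives a step
   y <> 0 whose multiples up to c t s^(1/r) all lie in the dilate. *)

Local Open Scope fset_scope.
Local Open Scope ring_scope.

(** * Sumsets of finite sets *)

(** The growth factor 4^(d+1) keeps [s m^(d+1)] from dropping: pairing is repeated only while at
    least a quarter as many pairs as sets are available, so [m] loses at most a factor 4. The
    exponent d + 1, rather than d, is what makes the case of large dimension collide with the
    trivial bound [l n]. The progression needs only the exponent d, and this follows by cancelling
    one factor, as [m <= l]. All constants are uniform only for sets above a size threshold, whereas
    |A| may be as small as 2; blocks of boundedly many sets are therefore added up beforehand, at a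
    constant cost in [l]. The reason for the multiples [q x] is that [P] is built from [Y] alone and
    need not lie in sums of the other sets: all that passes to them is that [X_i + P] is small. *)

Definition addfs (V : zmodType) (A B : {fset V}) : {fset V} :=
  [fset x + y | x in A, y in B].
Definition oppfs (V : zmodType) (A : {fset V}) : {fset V} := [fset - x | x in A].
Fixpoint mulfs (V : zmodType) (A : {fset V}) (n : nat) : {fset V} :=
  if n is m.+1 then addfs (mulfs A m) A else [fset 0].

Local Notation "A ⊕ B" := (addfs A B) (at level 50, left associativity).
Local Notation "⊖ A" := (oppfs A) (at level 35, right associativity).

Lemma addfsP (V : zmodType) (A B : {fset V}) z :
  reflect (exists x y, [/\ x \in A, y \in B & z = x + y]) (z \in A ⊕ B).
Proof.
apply: (iffP (imfset2P _ _ _ _ _)) => /=.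
  by move=> [x xA [y yB ->]]; exists x, y.
by move=> [x [y [xA yB ->]]]; exists x => //; exists y.
Qed.

Lemma mem_addfs (V : zmodType) (A B : {fset V}) x y :
  x \in A -> y \in B -> x + y \in A ⊕ B.
Proof. by move=> xA yB; apply/addfsP; exists x, y. Qed.

Lemma mem_oppfs (V : zmodType) (A : {fset V}) x : (x \in ⊖ A) = (- x \in A).
Proof.
apply/imfsetP/idP => [[y /= yA ->]|xA]; first by rewrite opprK.
by exists (- x); rewrite ?opprK.
Qed.

Lemma card_oppfs (V : zmodType) (A : {fset V}) : #|` ⊖ A| = #|` A|.
Proof. by rewrite card_imfset //; exact: oppr_inj. Qed.

Lemma addfsC (V : zmodType) (A B : {fset V}) : A ⊕ B = B ⊕ A.
Proof.
by apply/fsetP => z; apply/addfsP/addfsP => -[x [y [? ? ->]]];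
  exists y, x; rewrite addrC.
Qed.

Lemma addfsA (V : zmodType) (A B C : {fset V}) : A ⊕ (B ⊕ C) = A ⊕ B ⊕ C.
Proof.
apply/fsetP => z; apply/addfsP/addfsP.
  move=> [x [_ [xA /addfsP[y [w [yB wC ->]]] ->]]].
  by exists (x + y), w; rewrite addrA mem_addfs.
move=> [_ [w [/addfsP[x [y [xA yB ->]]] wC ->]]].
by exists x, (y + w); rewrite addrA mem_addfs.
Qed.

Lemma add0fs (V : zmodType) (A : {fset V}) : [fset 0] ⊕ A = A.
Proof.
apply/fsetP => z; apply/addfsP/idP => [[x [y [/fset1P -> yA ->]]]|zA].
  by rewrite add0r.
by exists 0, z; rewrite add0r fset11.
Qed.

Lemma addfsS (V : zmodType) (A A' B B' : {fset V}) :
  A `<=` A' -> B `<=` B' -> A ⊕ B `<=` A' ⊕ B'.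
Proof.
move=> /fsubsetP sA /fsubsetP sB; apply/fsubsetP => z.
by move=> /addfsP[x [y [/sA xA /sB yB ->]]]; exact: mem_addfs.
Qed.

Lemma card_addfs1 (V : zmodType) (A : {fset V}) b : #|` A ⊕ [fset b]| = #|` A|.
Proof.
have -> : A ⊕ [fset b] = [fset x + b | x in A].
  apply/fsetP => z; apply/addfsP/imfsetP => /=.
    by move=> [x [_ [xA /fset1P -> ->]]]; exists x.
  by move=> [x xA ->]; exists x, b; rewrite fset11.
by rewrite card_imfset //; exact: addIr.
Qed.

Lemma leq_card_addfsl (V : zmodType) (A B : {fset V}) :
  B != fset0 -> (#|` A| <= #|` A ⊕ B|)%N.
Proof.
move=> /fset0Pn[b bB]; rewrite -(card_addfs1 A b).
by apply: fsubset_leq_card; apply: addfsS => //; rewrite fsub1set.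
Qed.

Lemma addfs_neq0 (V : zmodType) (A B : {fset V}) :
  A != fset0 -> B != fset0 -> A ⊕ B != fset0.
Proof.
move=> /fset0Pn[a aA] /fset0Pn[b bB]; apply/fset0Pn; exists (a + b).
exact: mem_addfs.
Qed.

Lemma oppfsD (V : zmodType) (A B : {fset V}) : ⊖ (A ⊕ B) = ⊖ A ⊕ ⊖ B.
Proof.
apply/fsetP => z; rewrite mem_oppfs; apply/addfsP/addfsP.
  move=> [x [y [xA yB e]]]; exists (- x), (- y).
  by rewrite !mem_oppfs !opprK -opprD -e opprK.
move=> [x [y [xA yB ->]]]; exists (- x), (- y).
by rewrite -!mem_oppfs opprD.
Qed.

Lemma oppfsK (V : zmodType) (A : {fset V}) : ⊖ ⊖ A = A.
Proof. by apply/fsetP => z; rewrite !mem_oppfs opprK. Qed.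

Lemma card_fsetM (T U : choiceType) (A : {fset T}) (B : {fset U}) :
  #|` A `*` B| = (#|` A| * #|` B|)%N.
Proof.
rewrite (perm_size (enum_imfset2 _ _)) /=; first by rewrite size_allpairs.
by move=> [x y] [x' y'] _ _ /= [-> ->].
Qed.

Lemma leq_card_fibers (T U : choiceType) (A : {fset T}) (B : {fset U})
    (f : T -> U) (n : nat) :
  (forall x, x \in A -> f x \in B) ->
  (forall y, y \in B -> (#|` [fset x in A | f x == y]| <= n)%N) ->
  (#|` A| <= #|` B| * n)%N.
Proof.
elim/finSet_rect: B A => B IH A fAB fn.
have [B0|/fset0Pn[y yB]] := eqVneq B fset0.
  have -> : A = fset0 by apply/fsetP => x; rewrite inE; apply/negP => /fAB; rewrite B0.
  by rewrite cardfs0.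
rewrite (cardfsD1 y B) yB mulnDl mul1n -(cardfsID [fset x in A | f x == y] A).
apply: leq_add.
  apply: leq_trans (fn y yB); apply: fsubset_leq_card; exact: fsubsetIr.
apply: IH; first by apply: fproperD1.
  move=> x; rewrite !inE => /andP[+ xA]; rewrite xA /= => ->; exact: fAB.
move=> z; rewrite !inE => /andP[_ zB]; apply: leq_trans (fn z zB).
apply: fsubset_leq_card; apply/fsubsetP => x; rewrite !inE.
by move=> /andP[/andP[_ ->] ->].
Qed.

Lemma pigeonhole (T U : choiceType) (A : {fset T}) (B : {fset U}) (f : T -> U) :
  A != fset0 -> (forall x, x \in A -> f x \in B) ->
  exists2 y, y \in B & (#|` A| <= #|` B| * #|` [fset x in A | f x == y]|)%N.
Proof.
move=> A0 fAB; apply: contrapT => no.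
have h y : y \in B -> (#|` B| * #|` [fset x in A | f x == y]| <= #|` A|.-1)%N.
  move=> yB; have A1 : (0 < #|` A|)%N by rewrite cardfs_gt0.
  rewrite -ltnS prednK // ltnNge; apply/negP => le; apply: no; by exists y.
have := @leq_card_fibers _ _ A B f (#|` A|.-1 %/ #|` B|) fAB.
have [x xA] := fset0Pn _ A0.
have B1 : (0 < #|` B|)%N by rewrite cardfs_gt0; apply/fset0Pn; exists (f x); exact: fAB.
move=> /(_ _)/wrap[y yB|]; first by rewrite leq_divRL // mulnC h.
have := leq_trunc_div #|` A|.-1 #|` B|; rewrite mulnC => le1 le2.
have := leq_trans le2 le1; rewrite leqNgt prednK ?leqnn // cardfs_gt0 //.
Qed.

(* Fix for each [d = a + c] a representation; then [(d, b)] is recovered from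
   the pair [(a + b, b - c)], which gives Ruzsa's triangle inequality. *)
Lemma ruzsa_triangle (V : zmodType) (A B C : {fset V}) :
  (#|` A ⊕ C| * #|` B| <= #|` A ⊕ B| * #|` B ⊕ ⊖ C|)%N.
Proof.
have rep d : {p : V * V | d \in A ⊕ C -> [/\ p.1 \in A, p.2 \in C & d = p.1 + p.2]}.
  case: (boolP (d \in A ⊕ C)) => [/addfsP/cid[x /cid[y h]]|_]; first by exists (x, y).
  by exists (0, 0).
pose S := (A ⊕ C) `*` B; pose T := (A ⊕ B) `*` (B ⊕ ⊖ C).
have -> : (#|` A ⊕ C| * #|` B| = #|` S|)%N by rewrite card_fsetM.
rewrite -card_fsetM -/T.
pose f (u : V * V) := ((sval (rep u.1)).1 + u.2, u.2 - (sval (rep u.1)).2).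
have finj : {in S &, injective f}.
  move=> [d b] [d' b']; rewrite !inE /= => /andP[dD _] /andP[dD' _] [e1 e2].
  have [_ _ ed] := svalP (rep d) dD; have [_ _ ed'] := svalP (rep d') dD'.
  have h (u v w : V) : u + w = (u + v) - (v - w).
    by rewrite addrKA opprK.
  have e : d = d' by rewrite ed ed' (h _ b) e1 e2 -h.
  by move: e1; rewrite e => /addrI ->.
have <- : #|` f @` S| = #|` S| by rewrite card_in_imfset.
apply: fsubset_leq_card; apply/fsubsetP => _ /imfsetP[[d b] /= + ->]; rewrite !inE /=.
move=> /andP[dD bB]; have [aA cC _] := svalP (rep d) dD.
by rewrite !mem_addfs // mem_oppfs opprK.
Qed.

(* Petridis: [A] minimizes the expansion ratio [#|A ⊕ B| / #|A|] among its
   nonempty subsets. *)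
Lemma petridis (V : zmodType) (A B C : {fset V}) :
  (forall W, W `<=` A -> (#|` A ⊕ B| * #|` W| <= #|` W ⊕ B| * #|` A|)%N) ->
  (#|` A ⊕ B ⊕ C| * #|` A| <= #|` A ⊕ B| * #|` A ⊕ C|)%N.
Proof.
move=> minA; elim/fset1U_rect: C => [|c C cC IH].
  have -> : A ⊕ B ⊕ fset0 = fset0.
    by apply/fsetP => z; rewrite inE; apply/negP => /addfsP[x [y [_]]]; rewrite inE.
  by rewrite cardfs0.
have addU (X : {fset V}) : X ⊕ (c |` C) = (X ⊕ C) `|` (X ⊕ [fset c]).
  apply/fsetP => z; rewrite inE; apply/addfsP/orP.
    move=> [x [y [xX /fset1UP[->|yC] ->]]].
      by right; apply: mem_addfs; rewrite ?fset11.
    by left; apply: mem_addfs.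
  move=> [] /addfsP[x [y [xX yC ->]]]; exists x, y; split=> //.
    by rewrite !inE yC orbT.
  by rewrite !inE -in_fset1 yC.
(* For [a] in [A'] the translate [a + B + c] is already covered, so [c] adds at most
   [|A + B| - |A' + B|] sums, and minimality bounds [|A' + B|] from below by its share. Elements of
   [A + c] already in [A + C] come from [A'], so [A + C] grows by at least [|A| - |A'|]. *)
pose A' := [fset a in A | [fset a] ⊕ B ⊕ [fset c] `<=` A ⊕ B ⊕ C].
have sA' : A' `<=` A by apply/fsubsetP => a; rewrite !inE => /andP[].
have le1 : (#|` A ⊕ B ⊕ (c |` C)| + #|` A' ⊕ B| <= #|` A ⊕ B ⊕ C| + #|` A ⊕ B|)%N.
  rewrite addU -(card_addfs1 (A' ⊕ B) c) -(card_addfs1 (A ⊕ B) c).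
  rewrite -[X in (_ <= X)%N]cardfsUI leq_add2l; apply: fsubset_leq_card.
  rewrite fsubsetI; apply/andP; split; last by rewrite !addfsS.
  apply/fsubsetP => _ /addfsP[_ [c' [/addfsP[a [b [aA' bB ->]]] cc ->]]].
  move: aA'; rewrite !inE => /andP[aA /fsubsetP]; apply.
  by rewrite !mem_addfs ?fset11.
have le2 : (#|` A ⊕ C| + #|` A| <= #|` A ⊕ (c |` C)| + #|` A'|)%N.
  rewrite addU -(card_addfs1 A c) -(card_addfs1 A' c) -cardfsUI leq_add2l.
  apply: fsubset_leq_card; apply/fsubsetP => z; rewrite inE => /andP[zC].
  move=> /addfsP[a [c' [aA /fset1P -> e]]]; apply/addfsP; exists a, c.
  rewrite fset11; split=> //; rewrite !inE aA /=; apply/fsubsetP => w.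
  move=> /addfsP[_ [_ [/addfsP[_ [b [/fset1P -> bB ->]]] /fset1P -> ->]]].
  move: zC; rewrite e => /addfsP[a2 [c2 [a2A c2C e2]]].
  by rewrite addrAC e2 addrAC !mem_addfs.
have := minA _ sA'; nia.
Qed.

(** A nonempty subset of [Z] with least ratio [|A + Y| / |A|] serves for all [n] at once: its ratio
    is at most [K], and [petridis] with [C = mulfs Y n] shows that each further summand [Y] costs at
    most that ratio. *)
Lemma plunnecke (V : zmodType) (K : nat) (Y Z : {fset V}) :
  Z != fset0 -> (#|` Z ⊕ Y| <= K * #|` Z|)%N ->
  exists Z', [/\ Z' `<=` Z, Z' != fset0 &
    forall n, (#|` Z' ⊕ mulfs Y n| <= K ^ n * #|` Z'|)%N].
Proof.
move=> Z0 ZY.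
have [A [/fset0Pn/fset0Pn A0 sAZ minA]] : exists A, [/\ A != fset0, A `<=` Z &
    forall W, W `<=` Z -> (#|` A ⊕ Y| * #|` W| <= #|` W ⊕ Y| * #|` A|)%N].
  pose r (A : {fset V}) : rat := (#|` A ⊕ Y|)%:R / (#|` A|)%:R.
  pose D := [fset A in fpowerset Z | A != fset0].
  have ZD : Z \in D by rewrite !inE /= fpowersetE fsubset_refl.
  pose A := [arg min_(A < [` ZD]) r (val A)]%O.
  exists (val A).
  rewrite /A; case: arg_minP => // -[B BD] _ /= Bmin.
  move: (BD); rewrite !inE /= fpowersetE => /andP[sB B0]; split=> // W sW.
  have [->|W0] := eqVneq W fset0; first by rewrite cardfs0 muln0.
  have WD : W \in D by rewrite !inE /= fpowersetE sW.
  have := Bmin [` WD] isT; rewrite /r /=.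
  rewrite ler_pdivrMr ?ltr0n ?cardfs_gt0 // mulrAC.
  rewrite ler_pdivlMr ?ltr0n ?cardfs_gt0 // -!natrM ler_nat.
  by [].
exists A; split=> //; elim=> [|n IH] /=.
  by rewrite addfsC add0fs expn0 mul1n.
have A1 : (0 < #|` A|)%N by rewrite cardfs_gt0.
have AK : (#|` A ⊕ Y| <= K * #|` A|)%N.
  have Z1 : (0 < #|` Z|)%N by rewrite cardfs_gt0.
  rewrite -(leq_pmul2r Z1); apply: leq_trans (minA Z (fsubset_refl _)) _.
  by rewrite mulnAC leq_mul2r ZY orbT.
have := @petridis V A Y (mulfs Y n) (fun W sW => minA W (fsubset_trans sW sAZ)).
rewrite -addfsA [Y ⊕ _]addfsC => h.
rewrite -(leq_pmul2r A1); apply: leq_trans h _.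
by apply: leq_trans (leq_mul AK IH) _; rewrite expnS mulnACA mulnA.
Qed.

(** The triangle inequality is applied through the subset [A] of [plunnecke], whose sum with [n Y]
    is small; one factor [|A|] cancels and the other is at most [|Z|]. *)
Lemma card_mulfs_sub (V : zmodType) (K : nat) (Y Z : {fset V}) n :
  Z != fset0 -> (#|` Z ⊕ Y| <= K * #|` Z|)%N ->
  (#|` mulfs Y n ⊕ ⊖ mulfs Y n| <= K ^ (n + n) * #|` Z|)%N.
Proof.
move=> Z0 /(plunnecke Z0)[A [sA A0 hA]].
have A1 : (0 < #|` A|)%N by rewrite cardfs_gt0.
rewrite -(leq_pmul2r A1).
have /leq_trans := ruzsa_triangle (mulfs Y n) A (⊖ mulfs Y n); apply.
rewrite oppfsK [mulfs Y n ⊕ A]addfsC expnD.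
have hn := hA n; have lA := fsubset_leq_card sA.
apply: leq_trans (leq_mul hn hn) _.
by rewrite mulnACA -!mulnA !leq_mul // -!mulnA.
Qed.

(** * Bogolyubov's lemma in the integers modulo N *)

Section CosineSums.
Variable R : realType.

(** The angle [2 pi k / N]. Fourier analysis modulo [N] is carried out with real cosines in place of
    complex characters. *)
Definition circ (N : nat) (k : int) : R := k%:~R * (pi *+ 2 / N%:R).

Lemma circD N k k' : circ N (k + k') = circ N k + circ N k'.
Proof. by rewrite /circ intrD mulrDl. Qed.

Lemma circN N k : circ N (- k) = - circ N k.
Proof. by rewrite /circ mulrNz mulNr. Qed.

Lemma cosD_int (q : int) (x : R) : cos (x + q%:~R * (pi *+ 2)) = cos x.
Proof.
have h (n : nat) (y : R) : cos (y + n%:R * (pi *+ 2)) = cos y.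
  by rewrite mulr_natl (periodicn (@cosD2pi R)).
case: q => n; first exact: h.
rewrite NegzE mulrNz mulNr -[RHS](h n.+1 x) -[in RHS](h n.+1).
by rewrite -[LHS](h n.+1) subrK -[LHS](h n.+1).
Qed.

Lemma cos_circ_mod (N : nat) (k k' : int) :
  (0 < N)%N -> (k = k' %[mod N])%Z -> cos (circ N k) = cos (circ N k').
Proof.
move=> N0 /eqP; rewrite eqz_mod_dvd => /dvdzP[q e].
have -> : k = k' + q * N by rewrite -e addrC subrK.
rewrite circD /circ intrM -mulrA [N%:~R * _]mulrC -[_ / _ * _]mulrA mulVf ?mulr1.
  exact: cosD_int.
by rewrite pnatr_eq0 -lt0n.
Qed.

Lemma cos_circ_ge0 (N : nat) (y : int) :
  (0 < N)%N -> (4 * `|y| <= N)%N -> 0 <= cos (circ N y).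
Proof.
move=> N0 hy; apply: cos_ge0_pihalf; rewrite -ler_norml /circ normrM.
have t0 : 0 <= pi *+ 2 / N%:R :> R by rewrite divr_ge0 ?ler0n // mulrn_wge0 // pi_ge0.
rewrite (ger0_norm t0).
rewrite -intr_norm mulrA ler_pdivrMr ?ltr0n // -mulr_natr.
have : `|y|%:~R * 4 <= N%:R :> R.
  rewrite -[4]/(4%:~R) -intrM -[N%:R]/(N%:~R) ler_int; lia.
by have := pi_ge0 R; nra.
Qed.

(** Orthogonality of characters. After multiplication by [2 sin h], with [h] half the angle step,
    every term is a difference of two sines and the sum telescopes over full periods. Replacing [k]
    by its residue first puts [h] strictly between 0 and [pi], so that [sin h] is not zero. *)
Lemma sum_cos_circ (N : nat) (k : int) : (0 < N)%N -> ~~ (N %| k)%Z ->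
  \sum_(0 <= i < N) cos (circ N (k * i)) = 0.
Proof.
move=> N0 Nk.
have N0R : N%:R != 0 :> R by rewrite pnatr_eq0 -lt0n.
pose r := (k %% N)%Z.
have r0 : 0 < r < N%:Z.
  rewrite ltz_pmod // andbT lt_neqAle modz_ge0 ?andbT ?eqz_nat -?lt0n //.
  by rewrite eq_sym; apply: contra Nk => /eqP/dvdz_mod0P.
have -> : \sum_(0 <= i < N) cos (circ N (k * i)) = \sum_(0 <= i < N) cos (circ N (r * i)).
  apply: eq_bigr => i _; apply: cos_circ_mod => //.
  by apply/eqP; rewrite -modzMml.
pose h := r%:~R * (pi / N%:R) : R.
have sh : 0 < sin h.
  have [r1 r2] := andP r0; have pi0 := pi_gt0 R.
  apply: sin_gt0_pi; rewrite /h mulr_gt0 ?ltr0z ?divr_gt0 ?ltr0n //=.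
  by rewrite mulrA ltr_pdivrMr ?ltr0n // mulrC ltr_pM2l // -[N%:R]/(N%:~R) ltr_int.
apply: (@mulfI _ (sin h *+ 2)); first by rewrite mulrn_eq0 /= gt_eqF.
rewrite mulr0 mulr_sumr.
pose f (i : nat) : R := sin (circ N (r * i) - h).
rewrite (eq_bigr (fun i => f i.+1 - f i)); last first.
  move=> i _; rewrite /f.
  have -> : circ N (r * i.+1) - h = circ N (r * i) + h.
    by rewrite -addn1 PoszD mulrDr mulr1 circD /circ /h; field.
  rewrite sinD sinB; ring.
rewrite telescope_sumr // /f mulr0 /circ mul0r sub0r.
have -> : (r * N)%:~R * (pi *+ 2 / N%:R) = r%:~R * (pi *+ 2) :> R.
  by rewrite intrM /=; field.
have sin_per (x : R) (q : int) : sin (x + q%:~R * (pi *+ 2)) = sin x.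
  by rewrite -!cosBpihalf addrAC cosD_int.
by rewrite [_ * _ - h]addrC sin_per subrr.
Qed.


Variables (N C : nat) (E : {fset int}).
Hypothesis (N0 : (0 < N)%N).

(** The squared modulus of the Fourier coefficient of [E] at the frequency [i]. *)
Let spec (i : nat) : R := \sum_(a <- E) \sum_(b <- E) cos (circ N ((a - b) * i)).

Let spec_ge0 i : 0 <= spec i.
Proof.
pose p := \sum_(a <- E) cos (circ N (a * i)).
pose q := \sum_(a <- E) sin (circ N (a * i)).
have -> : spec i = p ^+ 2 + q ^+ 2.
  rewrite !expr2 /p /q !big_distrlr -big_split; apply: eq_bigr => a _.
  rewrite -big_split; apply: eq_bigr => b _.
  by rewrite mulrBl circD circN cosB.
by rewrite addr_ge0 ?sqr_ge0.
Qed.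

Let spec0 : spec 0 = (#|` E|)%:R ^+ 2.
Proof.
rewrite /spec.
under eq_bigr do under eq_bigr do rewrite mulr0 /circ mul0r cos0.
under eq_bigr do rewrite big_const_seq count_predT iter_addr_0.
by rewrite big_const_seq count_predT iter_addr_0 expr2 mulr_natr.
Qed.

Hypothesis E_lt : forall a, a \in E -> 0 <= a < N%:Z.

(** Parseval's identity: only the diagonal survives, since distinct elements of [E] are distinct
    modulo [N]. *)
Let sum_spec : \sum_(0 <= i < N) spec i = N%:R * (#|` E|)%:R.
Proof.
rewrite /spec exchange_big /=.
rewrite (eq_big_seq (fun _ => N%:R)); last first.
  move=> a aE; rewrite exchange_big /= (big_fsetD1 a) //=.
  rewrite [X in _ + X]big_seq [X in _ + X]big1 ?addr0.
    under eq_bigr do rewrite subrr mul0r /circ mul0r cos0.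
    by rewrite sumr_const_nat subn0.
  move=> b; rewrite !inE => /andP[ba bE]; apply: sum_cos_circ => //.
  rewrite -eqz_mod_dvd !modz_small ?E_lt //.
  by rewrite eq_sym.
by rewrite big_const_seq count_predT iter_addr_0 mulr_natr.
Qed.

(** Fourier inversion for [E + E - E - E]: a product of three cosines splits into four, and if one
    of their frequencies were a multiple of [N], it would represent [x]. *)
Let conv (x : int) :
  (forall a b c d, a \in E -> b \in E -> c \in E -> d \in E ->
     ~~ (x == a + b - c - d %[mod N])%Z) ->
  \sum_(0 <= i < N) spec i ^+ 2 * cos (circ N (x * i)) = 0.
Proof.
move=> nrep.
have E4 i : spec i ^+ 2 * cos (circ N (x * i)) =
    \sum_(a <- E) \sum_(b <- E) \sum_(c <- E) \sum_(d <- E)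
      cos (circ N ((a - b) * i)) * cos (circ N ((c - d) * i)) * cos (circ N (x * i)).
  rewrite expr2 {1}/spec mulr_suml mulr_suml; apply: eq_bigr => a _.
  rewrite mulr_suml mulr_suml; apply: eq_bigr => b _.
  rewrite {1}/spec mulr_sumr mulr_suml; apply: eq_bigr => c _.
  by rewrite mulr_sumr mulr_suml.
under eq_bigr do rewrite E4.
rewrite exchange_big big_seq big1 //= => a aE.
rewrite exchange_big big_seq big1 //= => b bE.
rewrite exchange_big big_seq big1 //= => c cE.
rewrite exchange_big big_seq big1 //= => d dE.
have prod3 (u v w : R) : cos u * cos v * cos w =
    (cos (u + v + w) + cos (u + v - w) + cos (u - v + w) + cos (u - v - w)) / 4.
  by rewrite !(cosD, sinD, cosN, sinN); field.
have dvd (u v : int) : `|u|%N = `|v|%N -> (N %| u)%Z -> (N %| v)%Z.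
  by rewrite !dvdzE => ->.
under eq_bigr do rewrite prod3 -!circN -!circD -!mulNr -!mulrDl.
rewrite -mulr_suml !big_split /= !sum_cos_circ ?addr0 ?mul0r //.
- apply: contra (nrep a d b c aE dE bE cE); rewrite eqz_mod_dvd.
  by apply: dvd; lia.
- apply: contra (nrep b c a d bE cE aE dE); rewrite eqz_mod_dvd.
  by apply: dvd; lia.
- apply: contra (nrep a c b d aE cE bE dE); rewrite eqz_mod_dvd.
  by apply: dvd; lia.
- apply: contra (nrep b d a c bE dE aE cE); rewrite eqz_mod_dvd.
  by apply: dvd; lia.
Qed.

(* The large spectrum consists of the frequencies [i] with
   [spec i >= |E|^2 / (2C)]. *)
Lemma bogolyubov : (N <= C * #|` E|)%N ->
  exists2 G : seq int, (size G <= 2 * C ^ 2)%N &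
    forall x : int,
      (forall g, g \in G -> exists2 y : int, (4 * `|y| <= N)%N & (x * g = y %[mod N])%Z) ->
      exists a b c d, [/\ a \in E, b \in E, c \in E & d \in E] /\
        (x = a + b - c - d %[mod N])%Z.
Proof.
move=> NCE.
have CE0 : (0 < C * #|` E|)%N by apply: leq_trans NCE.
have [C0 E0] : (0 < C)%N /\ (0 < #|` E|)%N by apply/andP; rewrite -muln_gt0.
pose e : R := (#|` E|)%:R; pose Cr : R := C%:R; pose Nr : R := N%:R.
have e0 : 0 < e by rewrite ltr0n.
have Cr0 : 0 < Cr by rewrite ltr0n.
have NCe : Nr <= Cr * e by rewrite -natrM ler_nat.
pose big i := e ^+ 2 <= 2 * Cr * spec i.
exists [seq i%:Z | i <- iota 0 N & big i].
  (* Each large frequency contributes at least [e^2 / (2C)] to the total [N e <= C e^2] given by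
     Parseval, so there are at most [2C^2] of them. *)
  rewrite size_map -(ler_nat R) natrM natrX -/Cr.
  rewrite -(ler_pM2r (exprn_gt0 2 e0)).
  have -> : (size [seq i <- iota 0 N | big i])%:R * e ^+ 2
      = \sum_(0 <= i < N | big i) e ^+ 2.
    by rewrite big_const_seq iter_addr_0 mulr_natl size_filter /index_iota subn0.
  apply: (@le_trans _ _ (\sum_(0 <= i < N) 2 * Cr * spec i)).
    rewrite [leRHS](bigID big) /= -[leLHS]addr0 lerD //; first exact: ler_sum.
    by apply: sumr_ge0 => i _; rewrite !mulr_ge0 // ltW.
  rewrite -mulr_sumr sum_spec -/e -/Nr.
  have h : 0 <= (Cr * e - Nr) * (Cr * e) by rewrite mulr_ge0 ?subr_ge0 // mulr_ge0 // ltW.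
  nra.
move=> x hx; apply: contrapT => nrep.
suff : 0 < \sum_(0 <= i < N) spec i ^+ 2 * cos (circ N (x * i)).
  rewrite conv ?ltxx // => a b c d aE bE cE dE; apply/negP => /eqP h; apply: nrep.
  by exists a, b, c, d.
(* On the large spectrum the hypothesis on [x] makes the cosine nonnegative. Elsewhere one factor
   [spec i] is below [e^2 / (2C)] and Parseval sums the other, so all negative terms together stay
   below the term [e^4] of frequency 0. *)
have low i : (i < N)%N -> (0 < i)%N ->
    - (e ^+ 2 / (2 * Cr) * spec i) <= spec i ^+ 2 * cos (circ N (x * i)).
  move=> iN i0; have s0 := spec_ge0 i.
  have t0 : 0 <= e ^+ 2 / (2 * Cr) by rewrite divr_ge0 ?exprn_ge0 ?mulr_ge0 ?ltW.
  case: (boolP (big i)) => [bi|nbi].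
    have [|y y4 exy] := hx i.
      by apply/mapP; exists i => //; rewrite mem_filter bi mem_iota.
    have cy := cos_circ_ge0 N0 y4; rewrite (cos_circ_mod N0 exy).
    apply: (@le_trans _ _ 0); first by rewrite oppr_le0 mulr_ge0.
    by rewrite mulr_ge0 ?exprn_ge0.
  have hs : spec i <= e ^+ 2 / (2 * Cr).
    rewrite ler_pdivlMr ?mulr_gt0 // mulrC ltW //.
    by rewrite ltNge.
  have c1 := cos_geN1 (circ N (x * i)).
  have := mulr_ge0 s0 s0; move: hs c1 s0; rewrite expr2.
  move: (e ^+ 2 / _) (cos _) (spec i) => u v w; nra.
rewrite big_ltn // spec0 mulr0 /circ mul0r cos0 mulr1 -/e.
have -> : e ^+ 2 ^+ 2 = e ^+ 3 * e by ring.
have : - (e ^+ 2 / (2 * Cr) * (Nr * e - e ^+ 2)) <=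
    \sum_(1 <= i < N) spec i ^+ 2 * cos (circ N (x * i)).
  have -> : Nr * e - e ^+ 2 = \sum_(1 <= i < N) spec i.
    by rewrite -sum_spec big_ltn // spec0 addrC addKr.
  rewrite mulr_sumr -sumrN; apply: ler_sum_nat => i /andP[i0 iN]; exact: low.
have : e ^+ 2 / (2 * Cr) * (Nr * e - e ^+ 2) < e ^+ 3 * e.
  rewrite mulrAC ltr_pdivrMr ?mulr_gt0 //.
  have e20 : 0 < e ^+ 2 by rewrite exprn_gt0.
  have -> : e ^+ 3 * e * (2 * Cr) = e ^+ 2 * (e ^+ 2 * (2 * Cr)) by ring.
  rewrite ltr_pM2l //; nra.
lra.
Qed.

End CosineSums.

(** * Bases with bounded coordinates *)

Lemma maximal_free (F : fieldType) (vT : vectType F) (P : vT -> Prop) :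
  exists s : seq vT, [/\ free s, forall x, x \in s -> P x &
    forall x, P x -> x \in <<s>>%VS].
Proof.
have ext k (s : seq vT) : free s -> (forall x, x \in s -> P x) ->
    (\dim {:vT} - size s <= k)%N -> exists t : seq vT,
    [/\ free t, forall x, x \in t -> P x & forall x, P x -> x \in <<t>>%VS].
  elim: k s => [|k IH] s fs Ps hk.
    exists s; split=> // x _; have : <<s>>%VS = fullv.
      by apply/eqP; rewrite eqEdim subvf (eqP fs) -subn_eq0 -leqn0.
    by move=> ->; rewrite memvf.
  have [full|] := pselect (forall x, P x -> x \in <<s>>%VS); first by exists s.
  move=> /existsNP[x /not_implyP[Px /negP xs]].
  apply: (IH (x :: s)); first by rewrite free_cons xs.
    by move=> y; rewrite inE => /predU1P[-> //|/Ps].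
  have : (size s <= \dim {:vT})%N by rewrite -(eqP fs) dimvS ?subvf.
  by rewrite /=; lia.
by apply: (ext _ [::]) (leqnn _); rewrite ?nil_free.
Qed.

Lemma free_mapP (F : fieldType) (vT : vectType F) r (e : 'I_r -> vT) :
  reflect (forall c, \sum_i c i *: e i = 0 -> forall i, c i = 0)
          (free [seq e i | i <- enum 'I_r]).
Proof.
have nthE (c : 'I_r -> F) : \sum_i c i *: (map_tuple e (ord_tuple r))`_i = \sum_i c i *: e i.
  by apply: eq_bigr => i _; rewrite -tnth_nth tnth_map tnth_ord_tuple.
have -> : [seq e i | i <- enum 'I_r] = map_tuple e (ord_tuple r).
  by rewrite -val_ord_tuple.
apply: (iffP (@freeP _ _ _ (map_tuple e (ord_tuple r)))) => h c hc.
  by apply: h; rewrite nthE.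
by apply: h; rewrite -nthE.
Qed.

(* Choosing [e] among the vectors of [S] so as to maximize the absolute value
   of the determinant makes all Cramer coefficients at most [1]. *)
Lemma bounded_basis (F : realFieldType) (vT : vectType F) (S : seq vT) :
  exists r (e : 'I_r -> vT),
    [/\ forall i, e i \in S,
        free [seq e i | i <- enum 'I_r] &
        forall x, x \in S -> exists2 c : 'I_r -> F,
          x = \sum_i c i *: e i & forall i, `|c i| <= 1].
Proof.
have [s [fs sS Ss]] := maximal_free (fun x => x \in S).
pose r := size s; pose b := in_tuple s; exists r.
pose s_ (i : 'I_(size S)) := tnth (in_tuple S) i.
pose m (f : {ffun 'I_r -> 'I_(size S)}) := \matrix_(i, j) coord b j (s_ (f i)).
have ex i : exists k, s_ k = tnth b i.
  have /tnthP[k ->] : tnth b i \in in_tuple S by apply: sS; exact: mem_tnth.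
  by exists k.
pose f0 : {ffun 'I_r -> 'I_(size S)} := [ffun i => sval (cid (ex i))].
have m0 : m f0 = 1%:M.
  apply/matrixP => i j; rewrite !mxE ffunE (svalP (cid (ex i))).
  by rewrite (tnth_nth 0) coord_free.
pose f := [arg max_(f > f0) `|\det (m f)|]%O.
have fmax g : `|\det (m g)| <= `|\det (m f)|.
  by rewrite /f; case: arg_maxP => // h _; apply.
have uf : m f \in unitmx.
  rewrite unitmxE unitfE -normr_gt0; apply: lt_le_trans (fmax f0).
  by rewrite m0 det1 normr1.
pose e i := s_ (f i).
have mE i : e i = \sum_j m f i j *: tnth b j.
  rewrite {1}(@coord_span _ _ _ b _ (Ss (e i) (mem_tnth _ _))).
  by apply: eq_bigr => j _; rewrite mxE (tnth_nth 0).
have lin (c : 'rV_r) : \sum_i c 0 i *: e i = \sum_j (c *m m f) 0 j *: tnth b j.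
  under eq_bigr do rewrite mE scaler_sumr.
  rewrite exchange_big; apply: eq_bigr => j _; rewrite mxE scaler_suml.
  by apply: eq_bigr => i _; rewrite scalerA.
exists e; split.
- by move=> i; exact: mem_tnth.
- apply/free_mapP => c c0.
  have cr : \sum_i (\row_i c i) 0 i *: e i = 0.
    by rewrite -[RHS]c0; apply: eq_bigr => i _; rewrite mxE.
  have cm : (\row_i c i) *m m f = 0.
    apply/rowP => j; rewrite [RHS]mxE; move: cr; rewrite lin.
    under eq_bigr do rewrite (tnth_nth 0).
    by move=> h; exact: (elimT (@freeP _ _ _ b) fs _ h j).
  by move=> i; move: (congr1 (mulmx^~ (invmx (m f))) cm) => /=;
    rewrite mulmxK // mul0mx => /rowP/(_ i); rewrite !mxE.
- move=> x xS; have /(nthP 0)[k0 k0S xk] := xS.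
  pose k := Ordinal k0S; have sk : s_ k = x by rewrite /s_ (tnth_nth 0).
  pose u := \row_j coord b j x; pose c := u *m invmx (m f).
  exists (fun i => c 0 i).
    rewrite lin mulmxKV // {1}(@coord_span _ _ _ b _ (Ss x xS)).
    by apply: eq_bigr => j _; rewrite mxE (tnth_nth 0).
  move=> i; pose g : {ffun 'I_r -> _} := [ffun j => if j == i then k else f j].
  have : \det (m g) = c 0 i * \det (m f).
    rewrite (expand_det_row _ i) /c /invmx uf -scalemxAr mxE mulrAC.
    rewrite mulVf ?mul1r; last by rewrite -unitfE -unitmxE.
    rewrite mxE; apply: eq_bigr => j _; rewrite !mxE ffunE eqxx sk; congr (_ * _).
    rewrite /cofactor; congr (_ * \det _); apply/matrixP => p q.
    by rewrite !mxE ffunE eq_sym (negbTE (neq_lift _ _)).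
  move=> /(congr1 Num.norm); rewrite normrM => h.
  have d0 : 0 < `|\det (m f)| by rewrite normr_gt0 -unitfE -unitmxE.
  by rewrite -(ler_pM2r d0) mul1r -h.
Qed.

(** * Successive minima *)

Lemma leq_expl m n k : (m <= n)%N -> (m ^ k <= n ^ k)%N.
Proof. by case: k => // k; rewrite leq_exp2r. Qed.

(** The cube [[-1, 1]^r] is cut into cells of side [1 / q]. The floor of [c q] runs from [-q] to
    [q], whence [2 q + 1] cells in each direction. *)
Lemma cube_pigeonhole (T : choiceType) (S : {fset T}) r (c : T -> 'I_r -> rat) (q : nat) :
  S != fset0 -> (forall x, x \in S -> forall i, `|c x i| <= 1) ->
  exists F : {fset T}, [/\ F `<=` S, (#|` S| <= (2 * q + 1) ^ r * #|` F|)%N &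
    forall x y, x \in F -> y \in F -> forall i, `|c x i - c y i| * q%:R < 1].
Proof.
move=> S0 c1; pose f x i := (Num.floor (c x i * q%:R) + q)%R.
have fb x i : x \in S -> 0 <= f x i < (2 * q + 1)%N%:Z.
  move=> /c1/(_ i); rewrite ler_norml => /andP[l1 l2]; rewrite /f.
  rewrite -ltrBrDr -lerBlDr floor_ge_int floor_lt_int.
  have q0 : 0 <= q%:R :> rat by rewrite ler0n.
  rewrite sub0r -[leLHS]/((- (Posz q))%:~R) rmorphN /=.
  have -> : ((2 * q + 1)%N%:Z - q%:Z)%:~R = q%:R + 1 :> rat.
    have -> : (2 * q + 1)%N%:Z - q%:Z = (q + 1)%N%:Z by lia.
    by rewrite -[(Posz (q + 1))%:~R]/((q + 1)%:R) natrD.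
  by rewrite -[q%:~R]/(q%:R); apply/andP; split; nra.
pose g x := [ffun i => inord `|f x i| : 'I_(2 * q).+1].
pose B := [fset y in {: {ffun 'I_r -> 'I_(2 * q).+1}}].
have gB x : x \in S -> g x \in B by rewrite !inE.
have [y _ hy] := pigeonhole S0 gB.
exists [fset x in S | g x == y]; split.
- by apply/fsubsetP => x; rewrite !inE => /andP[].
- apply: leq_trans hy _; rewrite leq_mul2r; apply/orP; right.
  by rewrite card_finset card_ffun !card_ord addn1.
move=> x z; rewrite !inE => /andP[xS /eqP gx] /andP[zS /eqP gz] i.
have e : f x i = f z i.
  have := congr1 (fun h : {ffun 'I_r -> 'I_(2 * q).+1} => val (h i)) (etrans gx (esym gz)).
  rewrite !ffunE /=; have := fb x i xS; have := fb z i zS => h1 h2.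
  by rewrite !inordK; lia.
have q0 : 0 <= q%:R :> rat by rewrite ler0n.
rewrite -[X in _ * X](ger0_norm q0) -normrM mulrBl.
have [+ +] := (floor_itv (c x i * q%:R), floor_itv (c z i * q%:R)).
move/addIr: e => ->; rewrite intrD ltr_norml; lra.
Qed.

Definition is_norm (vT : vectType rat) (N : vT -> rat) : Prop :=
  (forall x y, N (x + y) <= N x + N y) /\ (forall a x, N (a *: x) = `|a| * N x).

(** Definiteness is required on the lattice only. Integral values of the norm provide discreteness:
    least radii are attained, and norm below [m] means norm at most [m - 1]. *)
Definition is_lattice (vT : vectType rat) (N : vT -> rat) (L : vT -> Prop) : Prop :=
  [/\ forall x y, L x -> L y -> L (x - y),
      forall x, L x -> exists k : nat, N x = k%:R &
      forall x, L x -> N x = 0 -> x = 0].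

Lemma norm_sum (vT : vectType rat) (N : vT -> rat) : is_norm N ->
  forall (I : finType) (c : I -> rat) (e : I -> vT) (a M : rat), 0 <= a ->
  (forall i, `|c i| <= a) -> (forall i, N (e i) <= M) -> 
  N (\sum_i c i *: e i) <= #|I|%:R * (a * M).
Proof.
move=> [tri hom] I c e a M a0 ca eM.
have N0 : N 0 = 0 by rewrite -(scale0r 0) hom normr0 mul0r.
have Nge0 x : 0 <= N x.
  have := tri x (- x); rewrite subrr N0 -scaleN1r hom normrN1 mul1r; lra.
apply: (@le_trans _ _ (\sum_i `|c i| * N (e i))).
  elim/big_ind2: _ => [|x1 y1 x2 y2 h1 h2|i _]; rewrite ?N0 ?hom //.
  exact: le_trans (tri _ _) (lerD h1 h2).
rewrite -sum1_card natr_sum mulr_suml ler_sum // => i _; rewrite mul1r.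
by rewrite ler_pM.
Qed.

Section Minima.
Variables (vT : vectType rat) (N : vT -> rat) (L : vT -> Prop).
Hypotheses (normN : is_norm N) (lattL : is_lattice N L).

(** Take coordinates bounded by 1 in a basis chosen from [S], and cells of side [1 / q] with [q]
    above [r M / m]. At most [r] vectors of norm at most [M] with coefficients below [1 / q] sum to
    norm less than [m], so differences within one cell land in the smaller ball. *)
Lemma lattice_cover (U : {vspace vT}) (M m : nat) (S : {fset vT}) r :
  S != fset0 -> (0 < m <= M)%N -> (\dim U <= r)%N ->
  (forall x, x \in S -> [/\ L x, N x <= M%:R & x \in U]) ->
  exists T : {fset vT}, [/\ T != fset0,
    (forall x, x \in T -> [/\ L x, N x < m%:R & x \in U]) &
    (#|` S| * m ^ r <= (3 * (r + 1) * M) ^ r * #|` T|)%N].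
Proof.
move=> S0 /andP[m0 mM] dU hS.
have [r0 [e [eS fe ce]]] := bounded_basis (enum_fset S).
have r0r : (r0 <= r)%N.
  apply: leq_trans dU; rewrite -(size_enum_ord r0) -(size_map e) -(eqP fe).
  by apply/dimvS/span_subvP => _ /mapP[i _ ->]; have [] := hS _ (eS i).
pose q := ((r * M) %/ m).+1; have q1 : (0 < q)%N by [].
pose c x i := if pselect (x \in S) is left xS then s2val (cid2 (ce x xS)) i else 0.
have cE x : x \in S -> x = \sum_i c x i *: e i /\ forall i, `|c x i| <= 1.
  by rewrite /c => xS; case: pselect => // xS'; case: cid2.
have [F [FS cardF hF]] := @cube_pigeonhole _ S r0 c q S0 (fun x xS => (cE x xS).2).
have [x0 x0F] : exists x0, x0 \in F.
  apply/fset0Pn; apply: contraTneq cardF => ->.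
  by rewrite cardfs0 muln0 leqn0 cardfs_eq0.
have [Lsub _ _] := lattL; have [Lx0 _ Ux0] := hS _ (fsubsetP FS _ x0F).
exists [fset x - x0 | x in F]; split.
- by apply/fset0Pn; exists (x0 - x0); apply/imfsetP; exists x0.
- move=> _ /imfsetP[x /= xF ->]; have [Lx _ Ux] := hS _ (fsubsetP FS _ xF).
  split; [exact: Lsub | | exact: rpredB].
  rewrite (cE x (fsubsetP FS _ xF)).1 (cE x0 (fsubsetP FS _ x0F)).1 -sumrB.
  under eq_bigr do rewrite -scalerBl.
  have q0 : 0 < q%:R :> rat by rewrite ltr0n.
  apply: le_lt_trans (norm_sum (a := q%:R^-1) (M := M%:R) normN _ _ _) _.
  + by rewrite invr_ge0 ltW.
  + by move=> i; rewrite -[leRHS]mul1r ler_pdivlMr // ltW // hF.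
  + by move=> i; have [] := hS _ (eS i).
  rewrite card_ord mulrA mulrAC ltr_pdivrMr // -!natrM ltr_nat.
  apply: (@leq_ltn_trans (r * M)); first by rewrite leq_mul2r r0r orbT.
  by rewrite [(m * q)%N]mulnC -ltn_divLR.
- have cF : #|` [fset x - x0 | x in F]| = #|` F|.
    by rewrite card_imfset //; exact: addIr.
  rewrite cF; apply: leq_trans (_ : ((3 * q) ^ r * #|` F|) * m ^ r <= _)%N.
    rewrite leq_mul2r; apply/orP; right; apply: leq_trans cardF _.
    rewrite leq_mul2r; apply/orP; right.
    apply: leq_trans (_ : (3 * q) ^ r0 <= _)%N; first by apply: leq_expl; lia.
    by rewrite leq_pexp2l //; lia.
  rewrite mulnAC -expnMn leq_mul2r; apply/orP; right.
  have h : (3 * q * m <= 3 * (r + 1) * M)%N.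
    have := leq_trunc_div (r * M) m; rewrite /q; nia.
  exact: leq_expl.
Qed.

(** The induction on the dimension in [lattice_minima] pays one factor of [lattice_cover] at each
    dimension it passes. *)
Fixpoint minima_const (r : nat) : nat :=
  if r is p.+1 then ((3 * (r + 1)) ^ r * minima_const p)%N else 1%N.

Lemma minima_constS p r : (p <= r)%N -> (minima_const p <= minima_const r)%N.
Proof.
move=> /subnK <-; elim: (r - p)%N => //= k IH; apply: leq_trans IH _.
by rewrite leq_pmull // expn_gt0 muln_gt0 addn1.
Qed.

(* Discrete form of Minkowski's second theorem.  With [m] minimal such that the
   lattice vectors of norm at most [m] still span, the vectors of norm less
   than [m] span a proper subspace, to which induction applies. *)
Lemma lattice_minima (b : seq vT) (M : nat) :
  free b -> (forall x, x \in b -> L x /\ N x <= M%:R) ->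
  exists s : seq vT, [/\ free s, size s = size b,
    {subset s <= <<b>>%VS},
    forall x, x \in s -> L x /\ N x <= M%:R &
    forall S : {fset vT}, (forall x, x \in S -> [/\ L x, N x <= M%:R & x \in <<b>>%VS]) ->
      (#|` S|)%:R * \prod_(x <- s) N x <= (minima_const (size b))%:R * M%:R ^+ size b].
Proof.
have [tri hom] := normN; have [Lsub Lint Ldef] := lattL.
have N0 : N 0 = 0 by rewrite -(scale0r 0) hom normr0 mul0r.
have [n] := ubnP (size b); elim: n => // n IH in b M * => /ltnSE bn fb bP.
have [b0|bpos] := posnP (size b).
  exists b; split=> //; first by move=> x xb; exact: memv_span.
  move=> S hS; rewrite (size0nil b0) big_nil mulr1 expr0 mulr1 /= ler_nat.
  have sub : S `<=` [fset 0].
    apply/fsubsetP => x /hS[_ _]; rewrite (size0nil b0) span_nil memv0 => /eqP ->.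
    exact: fset11.
  by rewrite -(cardfs1 (0 : vT)) fsubset_leq_card.
pose P m := `[< exists c : seq vT, [/\ free c, size c = size b, {subset c <= <<b>>%VS} &
  forall x, x \in c -> L x /\ N x <= m%:R] >].
have exP : exists m, P m.
  by exists M; apply/asboolP; exists b; split=> // x xb; exact: memv_span.
pose m := ex_minn exP.
have [c [fc cb cU hc]] : exists c : seq vT,
    [/\ free c, size c = size b, {subset c <= <<b>>%VS} &
    forall x, x \in c -> L x /\ N x <= m%:R] by rewrite /m; case: ex_minnP => ? /asboolP.
have mmin k : P k -> (m <= k)%N by rewrite /m; case: ex_minnP => ? _; apply.
have mM : (m <= M)%N.
  by apply: mmin; apply/asboolP; exists b; split=> // x xb; exact: memv_span.
have m0 : (0 < m)%N.
  rewrite lt0n; apply/negP => /eqP m0; case: c fc cb hc {cU} => [|x c].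
    by move=> _ e; rewrite -e in bpos.
  rewrite free_cons => /andP[xc _] _ /(_ x (mem_head _ _))[Lx].
  rewrite m0 => Nx; have Nx0 : N x = 0.
    by have [k kE] := Lint x Lx; move: Nx; rewrite kE ler_nat leqn0 => /eqP ->.
  by rewrite (Ldef x Lx Nx0) mem0v in xc.
have [d [fd dP dmax]] := maximal_free (fun x => [/\ L x, N x < m%:R & x \in <<b>>%VS]).
have m1 x : L x -> N x < m%:R -> N x <= m.-1%:R.
  by move=> /Lint[k ->]; rewrite ltr_nat ler_nat => km; rewrite -ltnS prednK.
have dsub : (<<d>> <= <<b>>)%VS by apply/span_subvP => x /dP[].
have db : (size d < size b)%N.
  rewrite ltn_neqAle -{2}(eqP fd) -(eqP fb) dimvS // andbT.
  apply/negP => /eqP db; have : (m <= m.-1)%N.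
    apply: mmin; apply/asboolP; exists d; split=> //; first by rewrite db (eqP fb).
      by move=> x /dP[].
    by move=> x /dP[Lx Nx _]; split=> //; exact: m1.
  by rewrite -ltnS prednK // ltnn.
have [||s [fs sd sU hs hS]] := IH d m.-1 _ fd; first exact: leq_trans db bn.
  by move=> x /dP[Lx Nx _]; split=> //; exact: m1.
have ext k (s1 : seq vT) : free s1 -> (size s1 + k = size b)%N -> exists t : seq vT,
    [/\ free (t ++ s1), size t = k & {subset t <= c}].
  elim: k s1 => [|k IHk] s1 fs1 hk; first by exists [::].
  have [x xc xs1] : exists2 x, x \in c & x \notin <<s1>>%VS.
    apply: contrapT => no; have : (<<c>> <= <<s1>>)%VS.
      apply/span_subvP => x xc; apply: contrapT => /negP h; apply: no; by exists x.
    by move=> /dimvS; rewrite (eqP fc) (eqP fs1) cb -hk -[X in (_ <= X)%N]addn0 leq_add2l.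
  have [||t [ft st tc]] := IHk (x :: s1); first by rewrite free_cons xs1.
    by rewrite /= -hk; lia.
  exists (rcons t x); split; first by rewrite cat_rcons.
    by rewrite size_rcons st.
  by move=> y; rewrite mem_rcons inE => /predU1P[-> //|/tc].
have [|t [ft st tc]] := ext (size b - size d)%N s fs; first by rewrite sd subnKC // ltnW.
have tsP x : x \in t ++ s -> L x /\ N x <= m%:R.
  rewrite mem_cat => /orP[/tc/hc //|/hs[Lx Nx]]; split=> //.
  by apply: le_trans Nx _; rewrite ler_nat leq_pred.
exists (t ++ s); split=> //.
- by rewrite size_cat st sd subnK // ltnW.
- move=> x; rewrite mem_cat => /orP[/tc/cU //|/sU]; exact: (subvP dsub).
- move=> x /tsP[Lx Nx]; split=> //; apply: le_trans Nx _; by rewrite ler_nat.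
move=> S hSS; have [->|S0] := eqVneq S fset0.
  by rewrite cardfs0 mul0r mulr_ge0 ?exprn_ge0 ?ler0n.
(* The ball of radius [M] is compared with the vectors of norm less than [m]. These all lie in
   [<<d>>], where the induction hypothesis counts them against the norms of [s]; the vectors of [t]
   have norm at most [m] and supply the missing powers of [m]. *)
have [T [T0 hT cardT]] : exists T : {fset vT}, [/\ T != fset0,
    (forall x, x \in T -> [/\ L x, N x < m%:R & x \in <<b>>%VS]) &
    (#|` S| * m ^ size b <= (3 * (size b + 1) * M) ^ size b * #|` T|)%N].
  by apply: lattice_cover hSS; rewrite ?m0 // (eqP fb).
have {}hS : (#|` T|)%:R * \prod_(x <- s) N x <= (minima_const (size d))%:R * m%:R ^+ size d.
  apply: le_trans (hS T _) _.
    move=> x xT; have [Lx Nx Ux] := hT x xT; split=> //; [exact: m1|exact: dmax].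
  rewrite ler_wpM2l ?ler0n // lerXn2r ?nnegrE ?ler0n // ler_nat; exact: leq_pred.
have Nge0 x : 0 <= N x.
  have := tri x (- x); rewrite subrr N0 -scaleN1r hom normrN1 mul1r; lra.
have ht : \prod_(x <- t) N x <= m%:R ^+ (size b - size d).
  rewrite -st; elim: (t) tc => [|y t' IHt] tc'; first by rewrite big_nil expr0.
  rewrite big_cons exprS ler_pM ?prodr_ge0 //.
    by have [] := hc y (tc' y (mem_head _ _)).
  by apply: IHt => z zt; apply: tc'; rewrite inE zt orbT.
set r := size b in bpos bn db cb ht st cardT *; set p := size d in db hS ht st *.
have mr0 : 0 < m%:R ^+ r :> rat by rewrite exprn_gt0 ?ltr0n.
rewrite -(ler_pM2r mr0) big_cat /=.
set A := \prod_(x <- t) _ in ht *; set B := \prod_(x <- s) _ in hS *.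
have A0 : 0 <= A by exact: prodr_ge0.
have B0 : 0 <= B by exact: prodr_ge0.
have -> : (#|` S|)%:R * (A * B) * m%:R ^+ r = ((#|` S|)%:R * m%:R ^+ r) * A * B by ring.
have cT : (#|` S|)%:R * m%:R ^+ r <= (3 * (r + 1) * M)%:R ^+ r * (#|` T|)%:R :> rat.
  by rewrite -!natrX -!natrM ler_nat.
have step1 : (#|` S|)%:R * m%:R ^+ r * A * B <=
    (3 * (r + 1) * M)%:R ^+ r * m%:R ^+ (r - p) * ((#|` T|)%:R * B).
  have -> : (3 * (r + 1) * M)%:R ^+ r * m%:R ^+ (r - p) * ((#|` T|)%:R * B) =
    ((3 * (r + 1) * M)%:R ^+ r * (#|` T|)%:R) * m%:R ^+ (r - p) * B by ring.
  rewrite ler_wpM2r // ler_pM // mulr_ge0 ?exprn_ge0 ?ler0n //.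
apply: le_trans step1 _.
apply: le_trans (_ : (3 * (r + 1) * M)%:R ^+ r * m%:R ^+ (r - p) *
  ((minima_const p)%:R * m%:R ^+ p) <= _).
  by rewrite ler_wpM2l ?mulr_ge0 ?exprn_ge0 ?ler0n.
have -> : (3 * (r + 1) * M)%:R ^+ r * m%:R ^+ (r - p) * ((minima_const p)%:R * m%:R ^+ p) =
    (3 * (r + 1))%:R ^+ r * (minima_const p)%:R * M%:R ^+ r * m%:R ^+ r :> rat.
  have -> : m%:R ^+ r = m%:R ^+ (r - p) * m%:R ^+ p :> rat by rewrite -exprD subnK // ltnW.
  by rewrite natrM exprMn; ring.
rewrite ler_wpM2r ?exprn_ge0 ?ler0n // ler_wpM2r ?exprn_ge0 ?ler0n //.
rewrite -natrX -natrM ler_nat; case: (r) bpos db => // r' _ pr' /=.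
by rewrite leq_mul2l minima_constS ?orbT.
Qed.

End Minima.

(** * Progressions in Bohr sets *)

Section SupNorm.
Variable n : nat.

Definition supnorm (v : 'rV[rat]_n) : rat := \big[Num.max/0]_j `|v 0 j|.

Lemma supnorm_ge (v : 'rV[rat]_n) j : `|v 0 j| <= supnorm v.
Proof. exact: (le_bigmax _ (fun j => `|v 0 j|)). Qed.

Lemma supnorm_le (v : 'rV[rat]_n) a : 0 <= a -> (forall j, `|v 0 j| <= a) -> supnorm v <= a.
Proof. by move=> a0 h; apply/bigmax_leP; split. Qed.

Lemma supnorm_ge0 v : 0 <= supnorm v.
Proof. exact: bigmax_ge_id. Qed.

Lemma supnorm_is_norm : is_norm supnorm.
Proof.
split=> [x y|a x].
  apply: supnorm_le => [|j]; first by rewrite addr_ge0 ?supnorm_ge0.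
  rewrite mxE; apply: le_trans (ler_normD _ _) _.
  by apply: lerD; exact: supnorm_ge.
have [->|a0] := eqVneq a 0.
  rewrite scale0r normr0 mul0r; apply/le_anti; rewrite supnorm_ge0 andbT.
  by apply: supnorm_le => // j; rewrite mxE normr0.
have le b (y : 'rV[rat]_n) : supnorm (b *: y) <= `|b| * supnorm y.
  apply: supnorm_le => [|j]; first by rewrite mulr_ge0 ?supnorm_ge0.
  by rewrite mxE normrM ler_wpM2l ?supnorm_ge.
apply/le_anti; rewrite le /=.
have := le a^-1 (a *: x); rewrite scalerA mulVf // scale1r normrV ?unitfE //.
by rewrite mulrC ler_pdivlMr ?normr_gt0 // mulrC.
Qed.

Lemma supnorm_lattice (L : 'rV[rat]_n -> Prop) :
  (forall x y, L x -> L y -> L (x - y)) ->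
  (forall x, L x -> forall j, exists y : int, x 0 j = y%:~R) ->
  is_lattice supnorm L.
Proof.
move=> Lsub Lint; split=> // [x Lx|x Lx x0].
  rewrite /supnorm; elim/big_ind: _ => [|_ _ [k ->] [l ->]|j _].
  - by exists 0%N.
  - by exists (maxn k l); rewrite natr_max.
  by have [y ->] := Lint x Lx j; exists `|y|%N; rewrite -intr_norm -abszE.
apply/rowP => j; rewrite mxE; apply/eqP; rewrite -normr_le0 -x0; exact: supnorm_ge.
Qed.

End SupNorm.

Lemma card_int_range (n : nat) : #|` [fset i%:Z | i in iota 0 n]| = n.
Proof.
rewrite card_imfset /=; last by move=> x y [].
by rewrite undup_id ?iota_uniq // size_iota.
Qed.

Lemma mem_int_range (n : nat) (x : int) :
  (x \in [fset i%:Z | i in iota 0 n]) = (0 <= x < n%:Z).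
Proof.
apply/imfsetP/idP => [[i /=]|]; first by rewrite mem_iota => hi ->; lia.
by move=> hx; exists `|x|%N; rewrite /= ?mem_iota; lia.
Qed.

(** The first factor counts the cells of side [1 / 5], the second comes from [lattice_minima], and
    the last pays for dividing the radius among the at most [n + 1] steps. *)
Definition bohr_const (n : nat) : nat :=
  (11 ^ n.+1 * (minima_const n.+1 * n.+1 ^ n.+1))%N.

(** The lattice consists of the integer vectors congruent to [x (xi_0, ..., xi_n)] modulo [N]; since
    [xi_0 = 1], the coordinate 0 recovers [x]. The box spanned by short independent vectors stays
    within norm [M = N / 5]: this gives the Bohr condition, and two box points differ by at most
    [2M < N] in each coordinate, so congruent ones coincide as vectors. *)
Lemma bohr_gap (N n : nat) (xi : 'I_n.+1 -> int) :
  (0 < N)%N -> xi ord0 = 1 ->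
  exists r (w : 'I_r -> int) (m : 'I_r -> nat), [/\ (r <= n.+1)%N,
    forall k : 'I_r -> int, (forall i, (`|k i| <= m i)%N) -> forall j,
      exists2 y : int, (4 * `|y| <= N)%N & ((\sum_i k i * w i) * xi j = y %[mod N])%Z,
    forall k k' : 'I_r -> int, (forall i, (`|k i| <= m i)%N) -> (forall i, (`|k' i| <= m i)%N) ->
      (\sum_i k i * w i = \sum_i k' i * w i %[mod N])%Z -> k =1 k' &
    (N <= bohr_const n * \prod_i (2 * m i + 1))%N].
Proof.
move=> N0 xi0; pose M := (N %/ 5)%N.
pose L (v : 'rV[rat]_n.+1) := exists x : int, forall j, exists2 y : int,
  v 0 j = y%:~R & (y = x * xi j %[mod N])%Z.
have Lsub x y : L x -> L y -> L (x - y).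
  move=> [a ha] [b hb]; exists (a - b) => j.
  have [u hu ua] := ha j; have [v hv vb] := hb j; exists (u - v).
    by rewrite !mxE hu hv rmorphB.
  apply/eqP; rewrite eqz_mod_dvd.
  have -> : u - v - (a - b) * xi j = (u - a * xi j) - (v - b * xi j) by ring.
  by apply: rpredB; rewrite -eqz_mod_dvd; apply/eqP.
have Lint x : L x -> forall j, exists y : int, x 0 j = y%:~R.
  by move=> [a ha] j; have [y hy _] := ha j; exists y.
have lattL := supnorm_lattice Lsub Lint; have normN := supnorm_is_norm n.+1.
have [b [fb bP bmax]] := maximal_free (fun x => L x /\ supnorm x <= M%:R).
have [s [fs sb sU sP hS]] := lattice_minima normN lattL fb bP.
pose r := size s; pose v (i : 'I_r) := tnth (in_tuple s) i.
have vs i : v i \in s by exact: mem_tnth.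
have /choice[nv nvE] : forall i, exists k : nat, supnorm (v i) = k%:R.
  by move=> i; have [_ h _] := lattL; apply: h; have [] := sP _ (vs i).
have /choice[vz vzP] : forall i, exists z : 'I_n.+1 -> int,
    forall j, v i 0 j = (z j)%:~R /\ (z j = z ord0 * xi j %[mod N])%Z.
  move=> i; have [[x hx] _] := sP _ (vs i).
  have /choice[z hz] : forall j, exists y : int, v i 0 j = y%:~R /\ (y = x * xi j %[mod N])%Z.
    by move=> j; have [y] := hx j; exists y.
  exists z => j; have [-> zj] := hz j; split=> //.
  have [_ z0] := hz ord0; move: z0; rewrite xi0 mulr1 => z0.
  by rewrite zj -[LHS]modzMml -z0 modzMml.
pose m i := (M %/ (r * nv i))%N.
pose w i := vz i ord0.
have nv_gt0 i : (0 < nv i)%N.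
  rewrite lt0n; apply/negP => /eqP h.
  have [_ _ def] := lattL; have [Lv _] := sP _ (vs i).
  have v0 : v i = 0 by apply: def => //; rewrite nvE h.
  by move: (vs i); rewrite v0 => /(free_not0 fs); rewrite eqxx.
have r_n : (r <= n.+1)%N.
  rewrite /r -(eqP fs); apply: leq_trans (dimvS (subvf _)) _.
  by rewrite dimvf /dim /= mul1n.
have vzle i j : (`|vz i j| <= nv i)%N.
  have := supnorm_ge (v i) j; rewrite nvE (vzP i j).1 -intr_norm.
  by rewrite -[(nv i)%:R]/((nv i)%:~R) ler_int; lia.
have sumM : (\sum_i m i * nv i <= M)%N.
  apply: leq_trans (_ : \sum_(i < r) M %/ r <= _)%N.
    apply: leq_sum => i _; rewrite /m divnMA; exact: leq_trunc_div.
  by rewrite sum_nat_const card_ord mulnC leq_trunc_div.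
have box (k : 'I_r -> int) j : (forall i, (`|k i| <= m i)%N) ->
    (`|(\sum_i k i * vz i j)%R| <= M)%N.
  move=> hk; apply: leq_trans sumM.
  have : `|\sum_i k i * vz i j| <= \sum_i (m i * nv i)%N%:Z.
    apply: le_trans (ler_norm_sum _ _ _) _; apply: ler_sum => i _.
    by rewrite normrM PoszM ler_pM // -abszE lez_nat.
  by rewrite -(big_morph Posz PoszD (erefl 0%N%:Z)); lia.
have modE (k : 'I_r -> int) j :
    (\sum_i k i * vz i j = (\sum_i k i * w i) * xi j %[mod N])%Z.
  apply/eqP; rewrite eqz_mod_dvd mulr_suml -sumrB; apply: rpred_sum => i _.
  rewrite -mulrA -mulrBr; apply: dvdz_mull; rewrite -eqz_mod_dvd.
  by apply/eqP; exact: (vzP i j).2.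
have M5 : (5 * M <= N)%N by rewrite mulnC leq_trunc_div.
exists r, w, m; split=> //.
- move=> k hk j; exists (\sum_i k i * vz i j); last by rewrite modE.
  by have := box k j hk; lia.
- move=> k k' hk hk' e.
  have z0 j : \sum_i (k i - k' i) * vz i j = 0.
    under eq_bigr do rewrite mulrBl.
    rewrite sumrB; have h1 := box k j hk; have h2 := box k' j hk'.
    have : (N %| \sum_i k i * vz i j - \sum_i k' i * vz i j)%Z.
      by rewrite -eqz_mod_dvd !modE -[X in X == _]modzMml e modzMml.
    rewrite dvdzE => dv; apply/eqP; rewrite -absz_eq0; apply: contraLR dv => nz.
    apply/negP => /dvdn_leq; rewrite lt0n nz => /(_ isT) /= hN.
    by move: h1 h2 hN M5 N0; clear; move: (\sum_i _) (\sum_i _) => X Y; lia.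
  have fv : \sum_i (k i - k' i)%:~R *: v i = 0.
    apply/rowP => j; rewrite summxE mxE.
    rewrite (eq_bigr (fun i => ((k i - k' i) * vz i j)%:~R)).
      by rewrite -rmorph_sum /= z0.
    by move=> i _; rewrite mxE (vzP i j).1 intrM.
  move: fv; under eq_bigr do rewrite /v (tnth_nth 0).
  move=> fv i; have := elimT (@freeP _ _ _ (in_tuple s)) fs (fun i => (k i - k' i)%:~R) fv i.
  by move/eqP; rewrite intr_eq0 subr_eq0 => /eqP.
pose A := [fset i%:Z | i in iota 0 N].
have AP x : x \in A -> 0 <= x < N%:Z by rewrite mem_int_range.
have cA : #|` A| = N by exact: card_int_range.
pose c (x : int) (j : 'I_n.+1) : rat := ((x * xi j) %% N)%Z%:~R / N%:R.
have N0q : 0 < N%:R :> rat by rewrite ltr0n.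
have NZ : N%:Z != 0 by rewrite eqz_nat -lt0n.
have c1 x : x \in A -> forall j, `|c x j| <= 1.
  move=> _ j; rewrite /c normrM normfV (gtr0_norm N0q) ler_pdivrMr // mul1r.
  rewrite -intr_norm -[N%:R]/(N%:~R) ler_int ger0_norm ?modz_ge0 //.
  by rewrite ltW // ltz_pmod.
have A0 : A != fset0 by rewrite -cardfs_gt0 cA.
(* Lower bound for the number of short lattice vectors: residues whose fractional parts [x xi_j / N]
   share a cell of side [1 / 5] differ by a lattice vector of norm at most [N / 5]. *)
have [F [FA cF hF]] := @cube_pigeonhole _ A n.+1 c 5 A0 c1.
have [x0 x0F] : exists x0, x0 \in F.
  apply/fset0Pn; apply: contraTneq cF => ->.
  by rewrite cardfs0 muln0 leqn0 cA -lt0n.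
pose V (x : int) : 'rV[rat]_n.+1 := \row_j (((x * xi j) %% N)%Z - ((x0 * xi j) %% N)%Z)%:~R.
have LV x : L (V x).
  exists (x - x0) => j; exists (((x * xi j) %% N)%Z - ((x0 * xi j) %% N)%Z).
    by rewrite mxE.
  apply/eqP; rewrite eqz_mod_dvd; set u := x * xi j; set u0 := x0 * xi j.
  have -> : (u %% N)%Z - (u0 %% N)%Z - (x - x0) * xi j =
    ((u %% N)%Z - u) - ((u0 %% N)%Z - u0) by rewrite /u /u0; ring.
  by apply: rpredB; rewrite -eqz_mod_dvd; apply/eqP; exact: modz_mod.
have NV x : x \in F -> supnorm (V x) <= M%:R.
  move=> xF; apply: supnorm_le => // j; rewrite mxE -intr_norm.
  rewrite -[M%:R]/(M%:~R) ler_int.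
  have := hF x x0 xF x0F j; rewrite /c -mulrBl normrM normfV (gtr0_norm N0q).
  rewrite mulrAC ltr_pdivrMr // mul1r -rmorphB /= -intr_norm -[5%:R]/(5%:~R) -[N%:R]/(N%:~R).
  rewrite -intrM ltr_int => h; rewrite -abszE lez_nat leq_divRL //; lia.
have Vinj : {in F &, injective V}.
  move=> x y xF yF /rowP/(_ ord0); rewrite !mxE xi0 !mulr1.
  move=> /eqP; rewrite eqr_int => /eqP/addIr.
  by rewrite !modz_small ?AP //; apply: (fsubsetP FA).
have := hS (V @` F); rewrite card_in_imfset //=.
move=> /(_ _)/wrap[|hF2].
  move=> _ /imfsetP[x /= xF ->]; split=> //; first exact: NV.
  by apply: bmax; split=> //; exact: NV.
have prodE : \prod_(x <- s) supnorm x = (\prod_i nv i)%:R.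
  by rewrite big_tnth natr_prod; apply: eq_bigr => i _; rewrite -nvE.
move: hF2; rewrite prodE -sb -/r -natrX -!natrM ler_nat => hF2.
have P0 : (0 < \prod_i nv i)%N by rewrite prodn_gt0.
have hM : (M ^ r <= r ^ r * (\prod_i nv i) * \prod_i (2 * m i + 1))%N.
  rewrite -[X in (X ^ X * _ * _)%N]card_ord -prod_nat_const -!big_split /=.
  rewrite -[X in (M ^ X)%N]card_ord -prod_nat_const; apply: leq_prod => i _.
  have r0 : (0 < r)%N by apply: leq_ltn_trans (ltn_ord i).
  have := ltn_ceil M (_ : 0 < r * nv i)%N; rewrite muln_gt0 r0 nv_gt0 -/(m i).
  move=> /(_ isT)/ltnW/leq_trans; apply.
  rewrite card_ord [leqRHS]mulnC leq_mul2r; apply/orP; right.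
  by rewrite addn1 ltnS mul2n -addnn leq_addr.
have h1 : (minima_const r <= minima_const n.+1)%N by exact: minima_constS.
have h2 : (r ^ r <= n.+1 ^ n.+1)%N.
  by apply: leq_trans (leq_expl r r_n) _; rewrite leq_pexp2l.
rewrite -cA; apply: leq_trans cF _; rewrite /bohr_const.
move: (minima_const n.+1) (minima_const r) h1 hF2 => C1 C2 h1 hF2.
rewrite -!mulnA leq_mul2l; apply/orP; right.
rewrite -(leq_pmul2r P0); apply: leq_trans hF2 _.
rewrite -[leqRHS]mulnA; apply: (leq_mul h1); apply: leq_trans hM _.
by rewrite [leqRHS]mulnAC !leq_mul2r h2 !orbT.
Qed.

(** * Ruzsa's model lemma *)

Lemma sum_mulfs (V : zmodType) (Y : {fset V}) (xs : seq V) :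
  {subset xs <= Y} -> \sum_(x <- xs) x \in mulfs Y (size xs).
Proof.
elim: xs => [|x xs IH] sY; first by rewrite big_nil fset11.
rewrite big_cons addrC /=; apply: mem_addfs; last by apply: sY; rewrite mem_head.
by apply: IH => y yxs; apply: sY; rewrite inE yxs orbT.
Qed.

(** For fixed nonzero [z], distinct [l] give distinct nonzero residues [l z], of which at most
    [(p - 1) / N] are multiples of [N]. Since [0] is in [T], fewer than [N] values of [z] matter, so
    the excluded [l] do not fill all [p - 1] places. *)
Lemma good_dilation (N p : nat) (T : {fset int}) : prime p -> (0 < N)%N ->
  0 \in T -> (#|` T| <= N)%N -> (forall z, z \in T -> (`|z| < p)%N) ->
  exists l : int, [/\ 0 < l < p%:Z &
    forall z, z \in T -> z != 0 -> ~~ (N %| ((l * z) %% p)%Z)%Z].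
Proof.
move=> pp N0 T0 TN Tp; apply: contrapT => no.
have p0 : (0 < p)%N by exact: prime_gt0.
have p1 : (1 < p)%N by exact: prime_gt1.
have pZ : p%:Z != 0 by rewrite eqz_nat -lt0n.
pose A : {fset int} := [fset i%:Z + 1 | i in iota 0 p.-1].
have AP x : x \in A -> 0 < x < p%:Z.
  by move=> /imfsetP[i /=]; rewrite mem_iota => hi ->; lia.
have cA : #|` A| = p.-1.
  rewrite card_imfset /=; last by move=> x y /addIr [].
  by rewrite undup_id ?iota_uniq // size_iota.
have bad l : exists z : int, l \in A ->
    [/\ z \in T, z != 0 & (N %| ((l * z) %% p)%Z)%Z].
  have [lA|] := boolP (l \in A); last by exists 0.
  apply: contrapT => h; apply: no; exists l; split; first exact: AP.
  move=> z zT z0; apply/negP => Nz; apply: h; by exists z.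
have [f fP] := choice bad.
have nodiv l z : z \in T -> z != 0 -> 0 < l < p%:Z -> ~~ (p %| l * z)%Z.
  move=> zT z0 l0; rewrite dvdzE abszM /= Euclid_dvdM // negb_or.
  have := Tp z zT => zp; apply/andP; split; apply/negP => /dvdn_leq; lia.
have h : (#|` A| <= #|` T `\ (0 : int)| * (p.-1 %/ N))%N.
  apply: (@leq_card_fibers _ _ A (T `\ (0 : int)) f) => [l lA|z].
    by have [zT z0 _] := fP l lA; rewrite !inE z0.
  rewrite !inE => /andP[z0 zT].
  set F := [fset x in A | f x == z].
  pose g (l : int) := (((l * z) %% p)%Z %/ N)%Z - 1.
  have FP l : l \in F -> [/\ 0 < l < p%:Z, (N %| ((l * z) %% p)%Z)%Z & 0 < ((l * z) %% p)%Z].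
    rewrite !inE => /andP[lA /eqP fl]; have [_ _] := fP l lA; rewrite fl => Nl.
    split=> //; first exact: AP.
    rewrite lt_neqAle modz_ge0 // andbT eq_sym.
    by apply: contra (nodiv l z zT z0 (AP l lA)) => /eqP/dvdz_mod0P.
  have ginj : {in F &, injective g}.
    move=> l l' lF l'F /addIr e; have [l0 Nl _] := FP l lF; have [l'0 Nl' _] := FP l' l'F.
    have : (l * z = l' * z %[mod p])%Z by rewrite -(divzK Nl) e divzK.
    move/eqP; rewrite eqz_mod_dvd -mulrBl dvdzE abszM Euclid_dvdM //.
    have zp := Tp z zT; case/orP => /dvdn_leq h; last by lia.
    by apply: contrapT => ll; have := h; lia.
  have <- : #|` g @` F| = #|` F| by rewrite card_in_imfset.
  rewrite -(card_int_range (p.-1 %/ N)).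
  apply: fsubset_leq_card; apply/fsubsetP => _ /imfsetP[l /= lF ->].
  rewrite mem_int_range /g; have [_ Nl r0] := FP l lF.
  have rp : ((l * z) %% p)%Z < p%:Z by rewrite ltz_pmod.
  move: Nl r0 rp; set u := ((l * z) %% p)%Z => /dvdzP[q uq]; rewrite uq => r0 rp.
  rewrite mulzK; last by rewrite eqz_nat -lt0n.
  have q0 : 0 < q by move: r0; rewrite pmulr_lgt0.
  have : (`|q| <= p.-1 %/ N)%N by rewrite leq_divRL //; nia.
  lia.
rewrite cA in h.
have hT : (#|` T `\ (0 : int)| < N)%N by move: TN; rewrite (cardfsD1 (0 : int) T) T0 add1n.
have := leq_trunc_div p.-1 N; set q := (p.-1 %/ N)%N in h * => hq.
have : (q * #|` T `\ (0 : int)| < p.-1)%N \/ q = 0%N by case: (posnP q) => [->|q0]; [right|left; nia].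
case=> [|q0]; first by rewrite mulnC ltnNge h.
by move: h; rewrite q0 muln0; lia.
Qed.

(* Ruzsa's model lemma: reduce a random dilate modulo a large prime and then
   modulo [N]; summands from an interval of length [p / k] do not wrap. *)
Lemma freiman_model (k N : nat) (Y : {fset int}) : (0 < k)%N -> (0 < N)%N ->
  Y != fset0 -> (#|` mulfs Y k ⊕ ⊖ mulfs Y k| <= N)%N ->
  exists (psi : int -> int) (cls : int -> nat), [/\ forall y, 0 <= psi y < N%:Z,
    forall y, (cls y < k)%N &
    forall c (xs ys : seq int), size xs = k -> size ys = k ->
      (forall x, x \in xs ++ ys -> x \in Y /\ cls x = c) ->
      (\sum_(x <- xs) psi x = \sum_(y <- ys) psi y %[mod N])%Z <->
      \sum_(x <- xs) x = \sum_(y <- ys) y].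
Proof.
move=> k0 N0 Y0; set T := mulfs Y k ⊕ ⊖ mulfs Y k => TN.
have memT xs ys : size xs = k -> size ys = k -> {subset xs <= Y} -> {subset ys <= Y} ->
    \sum_(x <- xs) x - \sum_(y <- ys) y \in T.
  move=> sx sy hx hy; apply: mem_addfs; first by rewrite -sx sum_mulfs.
  by rewrite mem_oppfs opprK -sy sum_mulfs.
have T0 : 0 \in T.
  have [y yY] := fset0Pn _ Y0.
  have sub : {subset nseq k y <= Y} by move=> z /nseqP[-> _].
  by have := memT _ _ (size_nseq k y) (size_nseq k y) sub sub; rewrite subrr.
have [p0 p0T pp] := prime_above (\max_(z <- T) `|z|)%N.
set p := p0 in p0T pp.
have Tp z : z \in T -> (`|z| < p)%N.
  by move=> zT; apply: leq_ltn_trans p0T; apply: (@leq_bigmax_seq _ _ xpredT (fun z : int => `|z|%N)).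
have [l [l0 hl]] := good_dilation pp N0 T0 TN Tp.
have pZ : p%:Z != 0 by rewrite eqz_nat -lt0n prime_gt0.
have pgt0 : 0 < p%:Z by rewrite ltz_nat prime_gt0.
have NZ : N%:Z != 0 by rewrite eqz_nat -lt0n.
pose res (y : int) := ((l * y) %% p)%Z.
have resP y : 0 <= res y < p%:Z by rewrite modz_ge0 // ltz_pmod.
(* [cls y] tells which of the [k] intervals of length [p / k] contains the residue; inside one class
   two sums of [k] residues differ by less than [p]. *)
exists (fun y => (res y %% N)%Z), (fun y => `|((k%:Z * res y) %/ p)%Z|%N); split.
- by move=> y; rewrite modz_ge0 // ltz_pmod // ltz_nat.
- move=> y; have := resP y => /andP[r0 rp].
  have : (0 <= (k%:Z * res y) %/ p)%Z by rewrite divz_ge0 // mulr_ge0.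
  have : ((k%:Z * res y) %/ p < k%:Z)%Z by rewrite ltz_divLR // ltr_pM2l ?ltz_nat.
  lia.
move=> c xs ys sx sy hc.
have hcx x : x \in xs -> x \in Y /\ 0 <= k%:Z * res x - c%:Z * p%:Z <= p%:Z - 1.
  move=> xx; have [|xY xc] := hc x; first by rewrite mem_cat xx.
  split=> //; have := divz_eq (k%:Z * res x) p; have := ltz_pmod (k%:Z * res x) pgt0.
  have := modz_ge0 (k%:Z * res x) pZ.
  have : (0 <= (k%:Z * res x) %/ p)%Z.
    by rewrite divz_ge0 // mulr_ge0 //; have /andP[] := resP x.
  move: xc; set u := ((k%:Z * res x) %/ p)%Z => xc u0; have -> : u = c%:Z by lia.
  lia.
have hcy y : y \in ys -> y \in Y /\ 0 <= k%:Z * res y - c%:Z * p%:Z <= p%:Z - 1.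
  move=> xx; have [|xY xc] := hc y; first by rewrite mem_cat xx orbT.
  split=> //; have := divz_eq (k%:Z * res y) p; have := ltz_pmod (k%:Z * res y) pgt0.
  have := modz_ge0 (k%:Z * res y) pZ.
  have : (0 <= (k%:Z * res y) %/ p)%Z.
    by rewrite divz_ge0 // mulr_ge0 //; have /andP[] := resP y.
  move: xc; set u := ((k%:Z * res y) %/ p)%Z => xc u0; have -> : u = c%:Z by lia.
  lia.
have bnd zs : size zs = k ->
    (forall z, z \in zs -> z \in Y /\ 0 <= k%:Z * res z - c%:Z * p%:Z <= p%:Z - 1) ->
    0 <= k%:Z * (\sum_(z <- zs) res z - c%:Z * p%:Z) <= k%:Z * (p%:Z - 1).
  move=> sz hz.
  have -> : k%:Z * (\sum_(z <- zs) res z - c%:Z * p%:Z) =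
      \sum_(z <- zs) (k%:Z * res z - c%:Z * p%:Z).
    rewrite [RHS]sumrB [X in _ = _ - X]big_const_seq count_predT iter_addr_0 sz.
    by rewrite -mulr_sumr mulrBr -[(_ *+ k)%R]mulr_natl natz.
  rewrite big_seq sumr_ge0 => [|i /hz[_ /andP[]]//] /=.
  apply: (@le_trans _ _ (\sum_(i <- zs) (p%:Z - 1))).
    by rewrite [leRHS]big_seq; apply: ler_sum => i /hz[_ /andP[]].
  by rewrite big_const_seq count_predT iter_addr_0 sz -mulr_natl natz.
pose D := \sum_(x <- xs) res x - \sum_(y <- ys) res y.
pose z := \sum_(x <- xs) x - \sum_(y <- ys) y.
have Dp : - p%:Z < D < p%:Z.
  have kZ : 0 < k%:Z by [].
  have := bnd xs sx hcx; have := bnd ys sy hcy.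
  rewrite !(pmulr_rge0, ler_pM2l) // /D => /andP[a1 a2] /andP[a3 a4].
  move: a1 a2 a3 a4; move: (\sum_(x <- xs) res x) (\sum_(y <- ys) res y) (c%:Z * p%:Z).
  by clear; move=> X1 Y1 Z1; lia.
have sumN zs : (N %| \sum_(z <- zs) (res z %% N)%Z - \sum_(z <- zs) res z)%Z.
  rewrite -sumrB; apply: rpred_sum => y _; rewrite -eqz_mod_dvd; apply/eqP.
  exact: modz_mod.
have sump zs : (p %| \sum_(z <- zs) res z - l * \sum_(z <- zs) z)%Z.
  rewrite mulr_sumr -sumrB; apply: rpred_sum => y _; rewrite -eqz_mod_dvd; apply/eqP.
  exact: modz_mod.
have DN : ((\sum_(x <- xs) (res x %% N)%Z == \sum_(y <- ys) (res y %% N)%Z %[mod N])%Z)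
    = (N %| D)%Z.
  have hu := rpredB (sumN xs) (sumN ys).
  rewrite eqz_mod_dvd; have <- := rpredDl D hu.
  by congr (_ %| _)%Z; rewrite /D; ring.
have Dz : (p %| D - l * z)%Z.
  have -> : D - l * z = (\sum_(x <- xs) res x - l * \sum_(x <- xs) x) -
      (\sum_(y <- ys) res y - l * \sum_(y <- ys) y) by rewrite /D /z; ring.
  exact: rpredB (sump xs) (sump ys).
have hz : z = 0 <-> \sum_(x <- xs) x = \sum_(y <- ys) y.
  by rewrite /z; split=> [/eqP|->]; rewrite ?subrr // subr_eq0 => /eqP.
split=> [/eqP|/hz z0]; last first.
  apply/eqP; rewrite DN; move: Dz; rewrite z0 mulr0 subr0 => /dvdzP[q Dq].
  have [d1 d2] := andP Dp.
  have q1 : q < 1 by rewrite -(ltr_pM2r pgt0) mul1r -Dq.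
  have q2 : -1 < q by rewrite -(ltr_pM2r pgt0) mulN1r -Dq.
  have -> : D = 0 by rewrite Dq (_ : q = 0) ?mul0r //; move: q1 q2; clear; lia.
  exact: dvdz0.
rewrite DN => ND; apply/hz/eqP; apply: contraT => z0.
have subx : {subset xs <= Y} by move=> x /hcx[].
have suby : {subset ys <= Y} by move=> y /hcy[].
have zT : z \in T by exact: memT.
have nzT : - z \in T by rewrite /z opprB; exact: memT.
have rz : (D = l * z %[mod p])%Z by apply/eqP; rewrite eqz_mod_dvd.
(* As [|D| < p], either [D] is the residue of [l z] or [- D] is that of [l (- z)]. Both are
   multiples of [N], which the choice of [l] forbids for nonzero elements of the symmetric set
   [T]. *)
have [D0|D0] := leP 0 D.
  have := hl z zT z0; rewrite -rz modz_small ?ND //.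
  by rewrite D0; case/andP: Dp.
have rnz : (- D = l * - z %[mod p])%Z.
  by apply/eqP; rewrite mulrN eqz_mod_dvd opprK addrC -opprB dvdzE abszN -dvdzE.
have := hl (- z) nzT; rewrite oppr_eq0 => /(_ z0); rewrite -rnz modz_small.
  by rewrite dvdzE abszN -dvdzE ND.
by lia.
Qed.

(** * Progressions in 2Y - 2Y *)

(** Symmetric and without base point; translations are recorded separately. *)
Definition in_gap r (p : 'I_r -> int) (m : 'I_r -> nat) (x : int) : Prop :=
  exists2 k : 'I_r -> int, (forall i, (`|k i| <= m i)%N) & x = \sum_i k i * p i.

Definition box_point r (m : 'I_r -> nat) (f : {dffun forall i : 'I_r, 'I_(2 * m i + 1)})
  (i : 'I_r) : int := (f i)%:Z - (m i)%:Z.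

Lemma box_pointP r (m : 'I_r -> nat) f i : (`|@box_point r m f i| <= m i)%N.
Proof. by rewrite /box_point; have := ltn_ord (f i); lia. Qed.

Lemma card_box r (m : 'I_r -> nat) :
  #|{: {dffun forall i : 'I_r, 'I_(2 * m i + 1)}}| = (\prod_i (2 * m i + 1))%N.
Proof.
rewrite card_dep_ffun foldrE big_image /=.
by apply: eq_bigr => i _; rewrite card_ord.
Qed.

Lemma sum_mulfs_neq0 (V : zmodType) (Y : {fset V}) n : Y != fset0 -> mulfs Y n != fset0.
Proof.
move=> Y0; elim: n => [|n IH] /=; first by apply/fset0Pn; exists 0; rewrite fset11.
exact: addfs_neq0.
Qed.

Lemma oppfs_neq0 (V : zmodType) (Y : {fset V}) : Y != fset0 -> ⊖ Y != fset0.
Proof. by rewrite -!cardfs_gt0 card_oppfs. Qed.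

(** The size [2C^2] of the spectrum in [bogolyubov] at density [1 / C], with [C = 6 K^12]: [K^12]
    bounds [|6Y - 6Y| / |Y|], and 6 is the number of classes in the model. *)
Definition freiman_freq (K : nat) : nat := (2 * (6 * K ^ 12) ^ 2)%N.

(** The model of [Y] is dense modulo [N], so the Bohr set GAP lies in its [2E - 2E]; [Rel] lifts it
    back, by using the same four elements of [Y'] on both sides. Additivity of the lift compares
    three such representations, six terms on each side, which is why the model has order 6. *)
Lemma freiman_gap (R : realType) (K : nat) (Y Z : {fset int}) :
  Y != fset0 -> #|` Z| = #|` Y| -> (#|` Z ⊕ Y| <= K * #|` Y|)%N ->
  exists r (p : 'I_r -> int) (m : 'I_r -> nat) (S : {fset int}),
    [/\ (r <= (freiman_freq K).+1)%N,
        forall x, in_gap p m x -> x \in mulfs Y 2 ⊕ ⊖ mulfs Y 2,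
        forall x, x \in S -> in_gap p m x &
        (#|` Y| <= bohr_const (freiman_freq K) * #|` S|)%N].
Proof.
move=> Y0 cZ hK; have Z0 : Z != fset0 by rewrite -cardfs_gt0 cZ cardfs_gt0.
pose T := mulfs Y 6 ⊕ ⊖ mulfs Y 6; pose N := #|` T|.
have NK : (N <= K ^ 12 * #|` Y|)%N by rewrite -cZ; apply: card_mulfs_sub; rewrite ?cZ.
have YN : (#|` Y| <= N)%N.
  rewrite /N /T; apply: leq_trans (leq_card_addfsl _ (oppfs_neq0 (sum_mulfs_neq0 6 Y0))).
  by rewrite /= addfsC; apply: leq_card_addfsl; exact: (sum_mulfs_neq0 5 Y0).
have N0 : (0 < N)%N by apply: leq_trans YN; rewrite cardfs_gt0.
have [psi [cls [psiP clsP hpsi]]] := @freiman_model 6 N Y isT N0 Y0 (leqnn _).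
have [y _ |c _ hc] := @pigeonhole _ _ Y [fset i in iota 0 6] cls Y0.
  by have := clsP y; case: (cls y) => [|[|[|[|[|[|?]]]]]] // _; rewrite !inE.
rewrite card_imfset //= in hc.
pose Y' := [fset y in Y | cls y == c]; have {}hc : (#|` Y| <= 6 * #|` Y'|)%N by exact: hc.
have Y'P y : y \in Y' -> y \in Y /\ cls y = c by rewrite !inE => /andP[-> /eqP].
have Y'0 : Y' != fset0.
  by apply: contraTneq hc => ->; rewrite cardfs0 muln0 -ltnNge cardfs_gt0.
have [e eY'] := fset0Pn _ Y'0.
have iso (xs ys : seq int) : size xs = 6 -> size ys = 6 -> all (mem Y') (xs ++ ys) ->
    (\sum_(x <- xs) psi x = \sum_(y <- ys) psi y %[mod N])%Z <->
    \sum_(x <- xs) x = \sum_(y <- ys) y.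
  by move=> sx sy /allP h; apply: (hpsi c) => // x /h /Y'P.
pose E := psi @` Y'.
have cE : #|` E| = #|` Y'|.
  rewrite card_in_imfset //= => x y xY yY exy.
  have := iso [:: x; e; e; e; e; e] [:: y; e; e; e; e; e] erefl erefl.
  rewrite /= xY yY eY' => /(_ isT)[+ _]; rewrite !big_cons !big_nil exy => /(_ erefl).
  by move/addIr.
have NE : (N <= 6 * K ^ 12 * #|` E|)%N.
  rewrite cE; apply: leq_trans NK _; rewrite -mulnA mulnCA leq_mul2l.
  by rewrite hc orbT.
have EP a : a \in E -> 0 <= a < N%:Z by move=> /imfsetP[y _ ->]; exact: psiP.
have [G sG hG] := bogolyubov R N0 EP NE.
rewrite -/(freiman_freq K) in sG; set n := freiman_freq K in sG *.
(* The frequency 1 in front is the one [bohr_gap] asks for; positions beyond the end of [G] get the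
   frequency 0, which imposes no condition. *)
pose xi (j : 'I_n.+1) : int := if j == ord0 then 1 else nth 0 G j.-1.
have [r [w [m [rn bohr winj cm]]]] := bohr_gap N0 (erefl : xi ord0 = 1).
pose Rel (x z : int) := exists a b c d, [/\ a \in Y', b \in Y', c \in Y' & d \in Y'] /\
  (x = psi a + psi b - psi c - psi d %[mod N])%Z /\ z = a + b - c - d.
have eqin (u v : int) : u = v -> (N %| u)%Z -> (N %| v)%Z by move=> ->.
have RelD x x' x'' z z' z'' : (x'' = x + x' %[mod N])%Z ->
    Rel x z -> Rel x' z' -> Rel x'' z'' -> z'' = z + z'.
  move=> ex [a [b [c1 [d [[aY bY cY dY] [xE ->]]]]]].
  move=> [a' [b' [c' [d' [[a'Y b'Y c'Y d'Y] [x'E ->]]]]]].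
  move=> [a2 [b2 [c2 [d2 [[a2Y b2Y c2Y d2Y] [x''E ->]]]]]].
  have := iso [:: a; b; a'; b'; c2; d2] [:: c1; d; c'; d'; a2; b2] erefl erefl.
  rewrite /= aY bY cY dY a'Y b'Y c'Y d'Y a2Y b2Y c2Y d2Y => /(_ isT)[+ _].
  rewrite !big_cons !big_nil => h.
  have {}h : a + (b + (a' + (b' + (c2 + (d2 + 0))))) = c1 + (d + (c' + (d' + (a2 + (b2 + 0))))).
    apply: h; apply/eqP; rewrite eqz_mod_dvd.
    move/eqP: ex; move/eqP: xE; move/eqP: x'E; move/eqP: x''E; rewrite !eqz_mod_dvd.
    move=> d1 d2' d3 d4.
    by apply: (eqin _ _ _ (rpredB (rpredB (rpredB d1 d4) d2') d3)); ring.
  by move: h; clear; lia.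
have Rel_inj x x' z : Rel x z -> Rel x' z -> (x = x' %[mod N])%Z.
  move=> [a [b [c1 [d [[aY bY cY dY] [xE ->]]]]]].
  move=> [a' [b' [c' [d' [[a'Y b'Y c'Y d'Y] [x'E ez]]]]]].
  have := iso [:: a; b; c'; d'; e; e] [:: c1; d; a'; b'; e; e] erefl erefl.
  rewrite /= aY bY cY dY a'Y b'Y c'Y d'Y eY' => /(_ isT)[_].
  rewrite !big_cons !big_nil => /(_ _)/wrap[|/eqP]; first by move: ez; clear; lia.
  rewrite xE x'E eqz_mod_dvd => h; apply/eqP; rewrite eqz_mod_dvd.
  by apply: (eqin _ _ _ h); ring.
have RelE k : (forall i, (`|k i| <= m i)%N) -> exists z, Rel (\sum_i k i * w i) z.
  move=> hk; have [g gG|a [b [c1 [d [[aE bE cE' dE] h]]]]] := hG (\sum_i k i * w i).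
    pose j := index g G; have jn : (j.+1 < n.+1)%N.
      by rewrite ltnS; apply: leq_trans sG; rewrite index_mem.
    have [y y4 hy] := bohr k hk (Ordinal jn); exists y => //.
    by move: hy; rewrite /xi /= nth_index.
  move: aE bE cE' dE h => /imfsetP[a' /= aY ->] /imfsetP[b' /= bY ->].
  move=> /imfsetP[c' /= cY ->] /imfsetP[d' /= dY ->] h.
  by exists (a' + b' - c' - d'), a', b', c', d'.
have /choice[p hp] : forall i, exists z, (0 < m i)%N -> Rel (w i) z.
  move=> i; have [mi|mi] := posnP (m i); first by exists 0.
  have [|z hz] := RelE (fun j => (j == i)%:Z).
    by move=> j; case: eqP => [->|_] //; exact: mi.
  exists z => _; move: hz; rewrite (bigD1 i) //= eqxx mul1r big1 ?addr0 //.
  by move=> j /negbTE ->; rewrite mul0r.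
(* The lift is additive only inside the box, hence one unit step towards the origin at a time. A
   direction with [m i = 0] has no lift, but its coefficient is always zero. *)
have Rel_gap k : (forall i, (`|k i| <= m i)%N) -> Rel (\sum_i k i * w i) (\sum_i k i * p i).
  have [q] := ubnP (\sum_i `|k i|)%N; elim: q k => // q IH k /ltnSE hq hk.
  have [k0|[i ki]] : (forall i, k i = 0) \/ exists i, k i != 0.
    have [h|/existsNP[i /eqP h]] := pselect (forall i, k i = 0); [by left|].
    by right; exists i.
  - rewrite !big1 => [|i _|i _]; rewrite ?k0 ?mul0r //.
    by exists e, e, e, e; split=> //; split; [rewrite -addrA -opprD subrr|lia].
  pose sg := Num.sg (k i).
  pose k' j := if j == i then k i - sg else k j.
  have sgk : (sg = 1 /\ 0 < k i) \/ (sg = -1 /\ k i < 0).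
    by rewrite /sg; case: sgrP ki => // h _; [left|right].
  have hk' j : (`|k' j| <= m j)%N by rewrite /k'; case: eqP => [->|_] //; move: (hk i) sgk; clear; lia.
  have sk' : (\sum_j `|k' j| < q)%N.
    apply: leq_trans hq; rewrite (bigD1 i) //= [X in (_ < X)%N](bigD1 i) //= /k' eqxx.
    rewrite (eq_bigr (fun j => `|k j|%N)) => [|j /negbTE -> //].
    by rewrite ltn_add2r; move: sgk; clear; lia.
  have mi : (0 < m i)%N by move: (hk i) ki; clear; lia.
  have e_sum (u : 'I_r -> int) : \sum_j k j * u j = \sum_j k' j * u j + sg * u i.
    rewrite (bigD1 i) //= [in RHS](bigD1 i) //= /k' eqxx.
    rewrite [in RHS](eq_bigr (fun j => k j * u j)) => [|j /negbTE -> //]; ring.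
  have hIH := IH k' sk' hk'; have [z hz] := RelE k hk; have hi := hp i mi.
  suff <- : z = \sum_j k j * p j by [].
  rewrite e_sum; case: sgk => -[sgE _].
    rewrite sgE mul1r; apply: RelD hIH hi hz.
    by rewrite e_sum sgE mul1r.
  rewrite sgE mulN1r; apply/eqP; rewrite eq_sym subr_eq; apply/eqP.
  by apply: RelD hz hi hIH; rewrite e_sum sgE mulN1r subrK.
pose S := [fset \sum_i box_point f i * p i | f in {: {dffun forall i : 'I_r, 'I_(2 * m i + 1)}}].
exists r, p, m, S; split=> //.
- move=> x [k hk ->]; have [a [b [c1 [d [[aY bY cY dY] [_ ->]]]]]] := Rel_gap k hk.
  rewrite -addrA -opprD; apply: mem_addfs; last rewrite mem_oppfs opprK;
    by rewrite /= add0fs; apply: mem_addfs; apply: (Y'P _ _).1.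
- move=> _ /imfsetP[f _ ->]; exists (box_point f) => // i; exact: box_pointP.
apply: leq_trans YN _; apply: leq_trans cm _; rewrite leq_mul2l; apply/orP; right.
rewrite card_in_imfset /= => [|f g _ _ efg].
  by rewrite -card_box cardE.
have /winj : (\sum_i box_point f i * w i = \sum_i box_point g i * w i %[mod N])%Z.
  apply: (Rel_inj _ _ (\sum_i box_point f i * p i)).
    by apply: Rel_gap => i; exact: box_pointP.
  by rewrite efg; apply: Rel_gap => i; exact: box_pointP.
move=> h; apply/ffunP => i; apply: val_inj.
have := h (fun i => box_pointP f i) (fun i => box_pointP g i) i.
by rewrite /box_point => /addIr [].
Qed.

(** * Dilates of a generalized arithmetic progression *)

(** The spacing 3 exceeds 2, the largest value of [|a - b|]. *)
Lemma unit_gap (a b : rat) (i j : nat) : `|a| <= 1 -> `|b| <= 1 ->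
  a - b + ((3 * i)%:R - (3 * j)%:R) = 0 -> i = j.
Proof.
rewrite !natrM !ler_norml => /andP[a1 a2] /andP[b1 b2] h.
have [ij|ij|//] := ltngtP i j; exfalso.
  by move: ij; rewrite -(ler_nat rat) -addn1 natrD => ij; lra.
by move: ij; rewrite -(ler_nat rat) -addn1 natrD => ij; lra.
Qed.

Section GapProgressions.
Variables (r : nat) (p : 'I_r -> int) (m : 'I_r -> nat).

(** The GAP is the image of the integral vectors of the box under [phi]; rational vectors open the
    relations between the steps, the kernel of [phi], to linear algebra. *)
Let phi (v : 'rV[rat]_r) : rat := \sum_i v 0 i * (p i)%:~R.

Let phi_sum (I : finType) (c : I -> rat) (v : I -> 'rV[rat]_r) :
  phi (\sum_b c b *: v b) = \sum_b c b * phi (v b).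
Proof.
rewrite /phi; under [RHS]eq_bigr do rewrite mulr_sumr.
rewrite exchange_big; apply: eq_bigr => i _ /=.
by rewrite summxE mulr_suml; apply: eq_bigr => b _; rewrite mxE mulrA.
Qed.

Let phiB u v : phi (u - v) = phi u - phi v.
Proof. by rewrite /phi -sumrB; apply: eq_bigr => i _; rewrite !mxE mulrBl. Qed.

Let phiD u v : phi (u + v) = phi u + phi v.
Proof. by rewrite /phi -big_split; apply: eq_bigr => i _; rewrite !mxE mulrDl. Qed.

Let phiZ a v : phi (a *: v) = a * phi v.
Proof. by rewrite /phi mulr_sumr; apply: eq_bigr => i _; rewrite mxE mulrA. Qed.

Let boxed (a : rat) (v : 'rV[rat]_r) : Prop := forall i, `|v 0 i| <= a * (m i)%:R.

Let boxedD a b u v : boxed a u -> boxed b v -> boxed (a + b) (u + v).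
Proof.
move=> hu hv i; rewrite mxE mulrDl; exact: le_trans (ler_normD _ _) (lerD (hu i) (hv i)).
Qed.

Let boxedN a v : boxed a v -> boxed a (- v).
Proof. by move=> hv i; rewrite mxE normrN. Qed.

Let boxed_le a b v : a <= b -> boxed a v -> boxed b v.
Proof. by move=> ab hv i; apply: le_trans (hv i) _; rewrite ler_wpM2r ?ler0n. Qed.

Let boxed_sum (I : finType) (c : I -> rat) (v : I -> 'rV[rat]_r) a b :
  0 <= a -> (forall i, `|c i| <= a) -> (forall i, boxed b (v i)) ->
  boxed (#|I|%:R * (a * b)) (\sum_i c i *: v i).
Proof.
move=> a0 hc hv j; rewrite summxE; apply: le_trans (ler_norm_sum _ _ _) _.
rewrite -sum1_card natr_sum !mulr_suml; apply: ler_sum => i _.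
by rewrite mul1r mxE normrM -mulrA ler_pM ?hc; last exact: hv.
Qed.

Let integral_vec (v : 'rV[rat]_r) : Prop := forall i, v 0 i \is a Num.int.

Let integralB u v : integral_vec u -> integral_vec v -> integral_vec (u - v).
Proof. by move=> hu hv i; rewrite !mxE rpredB ?hu ?hv. Qed.

Let integral_sum (I : finType) (c : I -> int) (v : I -> 'rV[rat]_r) :
  (forall i, integral_vec (v i)) -> integral_vec (\sum_i (c i)%:~R *: v i).
Proof.
move=> hv j; rewrite summxE; apply: rpred_sum => i _; rewrite mxE.
by apply: rpredM; rewrite ?intr_int // hv.
Qed.

Let gap_of_vec (t : nat) (v : 'rV[rat]_r) (x : int) :
  integral_vec v -> boxed t%:R v -> phi v = x%:~R -> in_gap p (fun i => t * m i)%N x.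
Proof.
move=> iv bv px; exists (fun i => Num.floor (v 0 i)) => [i|].
  have := bv i; rewrite -{1}(floorK (iv i)) -intr_norm -natrM.
  by rewrite -[(t * m i)%:R]/((t * m i)%:~R) ler_int -abszE lez_nat.
apply: (@intr_inj rat); rewrite -px rmorph_sum; apply: eq_bigr => i _.
by rewrite rmorphM /= (floorK (iv i)).
Qed.

Let vec_of_gap x : in_gap p m x ->
  exists v, [/\ integral_vec v, boxed 1 v & phi v = x%:~R].
Proof.
move=> [k hk ->]; exists (\row_i (k i)%:~R); split.
- by move=> i; rewrite mxE intr_int.
- by move=> i; rewrite mxE mul1r -intr_norm -[(m i)%:R]/((m i)%:~R) ler_int -abszE lez_nat.
- by rewrite /phi rmorph_sum; apply: eq_bigr => i _; rewrite mxE rmorphM.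
Qed.

(* Work modulo the span [W] of the kernel vectors of size about [t].  If the
   quotient has dimension greater than [d], the [t]-fold dilate is large; if
   not, Dirichlet's pigeonhole principle in the quotient gives a step [y] all
   of whose small multiples can be brought back into the dilated box by
   subtracting elements of [W]. *)
Lemma gap_dichotomy (D d t : nat) (S : {fset int}) :
  (r <= D)%N -> (0 < d)%N -> (24 * (D + 1) ^ 2 <= t)%N -> (3 ^ d < #|` S|)%N ->
  (forall x, x \in S -> in_gap p m x) ->
  (exists2 S' : {fset int}, (forall x, x \in S' -> in_gap p (fun i => t * m i)%N x) &
     (t ^ d.+1 * #|` S| <= (96 * (D + 1) ^ 2) ^ d.+1 * #|` S'|)%N) \/
  (exists y : int, exists2 L : nat, y != 0 /\
     (forall j : nat, (j <= L)%N -> in_gap p (fun i => t * m i)%N (j%:Z * y)) &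
     (t ^ d * #|` S| <= (96 * (D + 1) ^ 2) ^ d * L ^ d)%N).
Proof.
move=> rD d0 tD Slarge Sgap; set E := (D + 1)%N in tD *.
have E0 : (0 < E)%N by rewrite /E addn1.
(* [tau] bounds the relations spanning [W], and [T] is the number of values of each coordinate in
   the large case. There two vectors of size [3 E T] must differ by a relation of size at most
   [tau], whence 6; in the other case the reduced vectors have size at most [4 E tau], whence 4. *)
pose tau := (t %/ (4 * E))%N; pose T := (tau %/ (6 * E))%N.
have tau_t : (4 * E * tau <= t)%N by rewrite mulnC leq_trunc_div.
have T_tau : (6 * E * T <= tau)%N by rewrite mulnC leq_trunc_div.
have tau6 : (6 * E <= tau)%N by rewrite leq_divRL ?muln_gt0 //; nia.
have T1 : (1 <= T)%N by rewrite leq_divRL ?muln_gt0 // mul1n.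
have t_tau : (t <= 8 * E * tau)%N.
  have := ltn_ceil t (_ : 0 < 4 * E)%N; rewrite muln_gt0 E0 -/tau => /(_ isT); nia.
have tau_T : (tau <= 12 * E * T)%N.
  have := ltn_ceil tau (_ : 0 < 6 * E)%N; rewrite muln_gt0 E0 -/T => /(_ isT); nia.
have t_T : (t <= 96 * E ^ 2 * T)%N.
  by apply: leq_trans t_tau _; rewrite -mulnn; nia.
have /choice[K KP] : forall x, exists v, x \in S ->
    [/\ integral_vec v, boxed 1 v & phi v = x%:~R].
  move=> x; have [xS|] := boolP (x \in S); last by exists 0.
  by have [v hv] := vec_of_gap (Sgap x xS); exists v.
have [sW [fW WP Wmax]] := maximal_free
  (fun v => [/\ integral_vec v, boxed tau%:R v & phi v = 0]).
set W := <<sW>>%VS in Wmax; pose pr v := v - projv W v.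
have prW v : v \in W -> pr v = 0 by move=> vW; rewrite /pr projv_id ?subrr.
have Wpr v : pr v = 0 -> v \in W by move/eqP; rewrite subr_eq0 => /eqP ->; exact: memv_proj.
have prD u v : pr (u - v) = pr u - pr v by rewrite /pr linearB /= opprD addrACA -opprD.
have prA u v : pr (u + v) = pr u + pr v by rewrite /pr linearD /= opprD addrACA.
have pr_sum (I : finType) (c : I -> rat) (v : I -> 'rV[rat]_r) :
    pr (\sum_b c b *: v b) = \sum_b c b *: pr (v b).
  rewrite /pr linear_sum -sumrB; apply: eq_bigr => b _; by rewrite linearZ scalerBr.
have WE v : v \in W -> exists c : 'I_(size sW) -> rat, v = \sum_b c b *: sW`_b.
  by move=> vW; exists (fun b => coord (in_tuple sW) b v); exact: (@coord_span _ _ _ (in_tuple sW)).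
have sWP (b : 'I_(size sW)) : [/\ integral_vec sW`_b, boxed tau%:R sW`_b & phi sW`_b = 0].
  by apply: WP; exact: mem_nth.
have phiW v : v \in W -> phi v = 0.
  by move=> /WE[c ->]; rewrite phi_sum big1 // => b _; have [_ _ ->] := sWP b; rewrite mulr0.
have szW : (size sW <= D)%N.
  rewrite -(eqP fW); apply: leq_trans (dimvS (subvf _)) _.
  by rewrite dimvf /dim /= mul1n.
have [n [e [eS fe ce]]] := bounded_basis [seq pr (K x) | x <- enum_fset S].
have nD : (n <= D)%N.
  rewrite -(size_enum_ord n) -(size_map e) -(eqP fe).
  apply: leq_trans (dimvS (subvf _)) _; by rewrite dimvf /dim /= mul1n.
have /choice[g gP] : forall i, exists x, x \in S /\ e i = pr (K x).
  by move=> i; have /mapP[x xS ->] := eS i; exists x.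
have /choice[c cP] : forall x, exists c : 'I_n -> rat, x \in S ->
    pr (K x) = \sum_i c i *: e i /\ forall i, `|c i| <= 1.
  move=> x; have [xS|] := boolP (x \in S); last by exists (fun=> 0).
  by have [|c h1 h2] := ce (pr (K x)); [apply: map_f | exists c].
have KgP i : [/\ integral_vec (K (g i)), boxed 1 (K (g i)) & phi (K (g i)) = (g i)%:~R].
  by apply: KP; have [] := gP i.
have prKg i : pr (K (g i)) = e i by have [_ ->] := gP i.
have pr_sumKg (a : 'I_n -> rat) : pr (\sum_i a i *: K (g i)) = \sum_i a i *: e i.
  by rewrite pr_sum; apply: eq_bigr => i _; rewrite prKg.
have [dn|nd] := ltnP d n.
  (* Equal values differ by a relation of size at most [tau], which vanishes modulo [W]. Coordinates
     in multiples of 3 then determine [u.2] by [unit_gap], although [K u.1] contributes coordinates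
     in [[-1, 1]]. *)
  left; pose vec (u : int * {ffun 'I_n -> 'I_T}) :=
    K u.1 + \sum_i (3 * (u.2 i : nat))%:Z%:~R *: K (g i).
  pose val (u : int * {ffun 'I_n -> 'I_T}) := u.1 + \sum_i (3 * (u.2 i : nat))%:Z * g i.
  have vecP u : u.1 \in S -> [/\ integral_vec (vec u), boxed (3 * E * T)%:R (vec u) &
      phi (vec u) = (val u)%:~R].
    move=> uS; have [i1 b1 p1] := KP _ uS; split.
    - move=> j; rewrite mxE rpredD //; apply: integral_sum => i; by have [] := KgP i.
    - apply: (@boxed_le (1 + n%:R * ((3 * (T - 1))%:R * 1))).
        have : (1 + n * (3 * (T - 1)) <= 3 * E * T)%N.
          by move: T1 nD dn; rewrite /E; clear; nia.
        by rewrite -(ler_nat rat) natrD natrM mulr1.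
      apply: boxedD => //; rewrite -[X in X%:R * _](card_ord n); apply: boxed_sum => //.
        move=> i; rewrite -pmulrn normr_nat ler_nat.
        by rewrite leq_mul2l /= -ltnS subn1 prednK.
      by move=> i; have [] := KgP i.
    - rewrite phiD p1 phi_sum /val intrD rmorph_sum /=; congr (_ + _).
      by apply: eq_bigr => i _; have [_ _ ->] := KgP i; rewrite rmorphM.
  pose U := S `*` [fset f in {: {ffun 'I_n -> 'I_T}}].
  have UP u : u \in U -> u.1 \in S by rewrite !inE => /andP[].
  exists (val @` U).
    move=> _ /imfsetP[u /= /UP/vecP[i1 b1 p1] ->].
    apply: gap_of_vec i1 _ p1; apply: boxed_le b1; rewrite ler_nat.
    move: tau_t T_tau E0; clear; nia.
  have vinj : {in U &, injective val}.
    move=> u u' /UP uS /UP u'S ev; have [i1 b1 p1] := vecP _ uS; have [i2 b2 p2] := vecP _ u'S.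
    have zW : vec u - vec u' \in W.
      apply: Wmax; split; first exact: integralB.
        apply: boxed_le (boxedD b1 (boxedN b2)); rewrite -natrD ler_nat.
        move: T_tau; clear; nia.
      by rewrite phiB p1 p2 ev subrr.
    have [c1 c1b] := cP _ uS; have [c2 c2b] := cP _ u'S.
    have z0 : \sum_i ((c u.1 i - c u'.1 i) +
        ((3 * (u.2 i : nat))%:R - (3 * (u'.2 i : nat))%:R)) *: e i = 0.
      rewrite -[RHS](prW _ zW) prD /vec.
      rewrite !prA !pr_sumKg c1 c2.
      rewrite -big_split -big_split -sumrB; apply: eq_bigr => i _ /=.
      by rewrite -!scalerDl -scalerBl; congr (_ *: _); rewrite /=; ring.
    have eu2 : u.2 = u'.2.
      apply/ffunP => i; apply: val_inj; have := elimT (free_mapP e) fe _ z0 i.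
      exact: unit_gap (c1b i) (c2b i).
    have eu1 : u.1 = u'.1 by move: ev; rewrite /val eu2 => /addIr.
    by rewrite (surjective_pairing u) eu1 eu2 -surjective_pairing.
  rewrite card_in_imfset //= card_fsetM card_finset card_ffun !card_ord.
  rewrite mulnCA mulnC leq_mul2l; apply/orP; right.
  apply: leq_trans (leq_expl _ t_T) _; rewrite expnMn leq_mul2l; apply/orP; right.
  by rewrite leq_pexp2l.
right.
(* The largest [q] with fewer than [|S|] cells in [d] dimensions: two points share a cell, and
   maximality gives [|S| <= (2 q + 3)^d <= (5 q)^d]. The hypothesis [3 ^ d < |S|] ensures
   [q >= 1]. *)
have exq : exists q, ((2 * q + 1) ^ d < #|` S|)%N.
  by exists 1%N.
have bq q : ((2 * q + 1) ^ d < #|` S|)%N -> (q <= #|` S|)%N.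
  move=> h; apply: leq_trans (ltnW h); apply: leq_trans (_ : 2 * q + 1 <= _)%N; first lia.
  by rewrite -[X in (X <= _)%N]expn1 leq_pexp2l ?addn1.
pose q := ex_maxn exq bq.
have [qS q1 qmax] : [/\ ((2 * q + 1) ^ d < #|` S|)%N, (1 <= q)%N &
    (#|` S| <= (5 * q) ^ d)%N].
  rewrite /q; case: ex_maxnP => k hk kmax; have k1 : (1 <= k)%N by apply: kmax.
  split=> //; rewrite leqNgt; apply/negP => h.
  have : (k.+1 <= k)%N; last by rewrite ltnn.
  by apply: kmax; apply: leq_ltn_trans h; apply: leq_expl; lia.
have S0 : S != fset0 by rewrite -cardfs_gt0; apply: leq_ltn_trans Slarge.
have [F [FS cF hF]] := @cube_pigeonhole _ S n c q S0 (fun x xS => (cP x xS).2).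
have F2 : (1 < #|` F|)%N.
  rewrite ltnNge; apply/negP => F1.
  have : ((2 * q + 1) ^ n * #|` F| <= (2 * q + 1) ^ d * 1)%N.
    by apply: leq_mul => //; rewrite leq_pexp2l ?addn1.
  by rewrite muln1 => /(leq_trans cF); rewrite leqNgt qS.
have [x [x' [xF x'F xx']]] : exists x x', [/\ x \in F, x' \in F & x != x'].
  have [x xF] : exists x, x \in F by apply/fset0Pn; rewrite -cardfs_gt0 ltnW.
  have /fset0Pn[x' ] : F `\ x != fset0.
    by rewrite -cardfs_gt0; move: F2; rewrite (cardfsD1 x) xF.
  by rewrite !inE => /andP[h x'F]; exists x, x'; rewrite eq_sym.
have xS := fsubsetP FS _ xF; have x'S := fsubsetP FS _ x'F.
pose Y := K x - K x'; pose del i := c x i - c x' i.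
have [ix bx px] := KP x xS; have [ix' bx' px'] := KP x' x'S.
have prY : pr (Y - \sum_i del i *: K (g i)) = 0.
  rewrite prD pr_sumKg prD (cP x xS).1 (cP x' x'S).1 -sumrB.
  by apply/eqP; rewrite subr_eq0; apply/eqP; apply: eq_bigr => i _; rewrite scalerBl.
exists (x - x'), (tau * q)%N; last first.
  apply: leq_trans (leq_mul (leq_expl d t_tau) qmax) _.
  rewrite -!expnMn; apply: leq_expl; move: E0; rewrite -mulnn; clear; nia.
split=> [|j jL]; first by rewrite subr_eq0.
have /WE[be hbe] : j%:R *: (Y - \sum_i del i *: K (g i)) \in W by apply/memvZ/Wpr.
pose s i := j%:R * del i.
pose fr (a : rat) := a - (Num.floor a)%:~R.
have fr1 a : `|fr a| <= 1.
  have /andP[h1 h2] := floor_itv a; rewrite /fr ger0_norm; last by lra.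
  by move: h2; rewrite intrD; lra.
(* Subtracting integral multiples of relations leaves [phi] unchanged. What remains has fractional
   coefficients on [W] and coefficients [s i] of size at most [tau q / q = tau] on the vectors
   [K (g i)]. *)
pose z := j%:R *: Y - \sum_b (Num.floor (be b))%:~R *: sW`_b.
have zE : z = (\sum_i fr (s i) *: K (g i) + \sum_b fr (be b) *: sW`_b) +
    \sum_i (Num.floor (s i))%:~R *: K (g i).
  have e1 : j%:R *: Y = \sum_i s i *: K (g i) + \sum_b be b *: sW`_b.
    move/eqP: hbe; rewrite scalerBr subr_eq addrC => /eqP ->; congr (_ + _).
    by rewrite scaler_sumr; apply: eq_bigr => i _; rewrite scalerA.
  have e2 (I : finType) (a : I -> rat) (v : I -> 'rV[rat]_r) :
      \sum_b a b *: v b = \sum_b fr (a b) *: v b + \sum_b (Num.floor (a b))%:~R *: v b.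
    by rewrite -big_split; apply: eq_bigr => b _ /=; rewrite -scalerDl subrK.
  by rewrite /z e1 e2 (e2 _ be) addrA addrK addrAC.
apply: (gap_of_vec (v := z)).
- apply: integralB; last by apply: integral_sum => b; have [] := sWP b.
  by move=> i; rewrite mxE; apply: rpredM; [exact: natr_int|exact: integralB].
- rewrite zE; apply: (@boxed_le ((n%:R * (1 * 1) + (size sW)%:R * (1 * tau%:R)) +
    n%:R * ((tau + 1)%:R * 1))).
    rewrite !mulr1 mul1r -!natrM -!natrD ler_nat.
    have : (n * (tau + 1) <= E * (2 * tau))%N by apply: leq_mul; move: nD tau6 E0; rewrite /E; clear; nia.
    have : (size sW * tau <= E * tau)%N by rewrite leq_mul2r; move: szW; rewrite /E; clear; lia.
    have : (n <= E * tau)%N by move: nD tau6; rewrite /E; clear; nia.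
    move: tau_t; clear; lia.
  apply: boxedD; first apply: boxedD.
  + rewrite -{1}(card_ord n); apply: boxed_sum => // i; by have [] := KgP i.
  + rewrite -{1}(card_ord (size sW)); apply: boxed_sum => // b; by have [] := sWP b.
  + rewrite -{1}(card_ord n); apply: boxed_sum => // i; last by have [] := KgP i.
    have hs : `|s i| <= tau%:R.
      rewrite /s normrM (ger0_norm (ler0n _ j)).
      have h := ltW (hF x x' xF x'F i); rewrite -/(del i) in h.
      apply: le_trans (_ : (tau * q)%:R * `|del i| <= _).
        by rewrite ler_wpM2r // ler_nat.
      by rewrite natrM -mulrA mulrC -mulrA mulrC; have := ler0n rat tau; nra.
    have /andP[h1 h2] := floor_itv (s i); rewrite intrD in h2.
    rewrite natrD; move: hs; rewrite !ler_norml => /andP[h3 h4]; lra.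
- rewrite /z phiB phi_sum big1 => [|b _]; last by have [_ _ ->] := sWP b; rewrite mulr0.
  by rewrite subr0 phiZ /Y phiB px px' rmorphM rmorphB.
Qed.

End GapProgressions.

(** * Regular families *)

HB.instance Definition _ (V : zmodType) := Monoid.isComLaw.Build {fset V} [fset 0]
  (@addfs V) (@addfsA V) (@addfsC V) (@add0fs V).

Definition sumfs (V : zmodType) (Xs : seq {fset V}) : {fset V} :=
  \big[@addfs V/[fset 0]]_(X <- Xs) X.

(** Inclusion up to translation, the relation that survives discarding nonempty summands; the
    translation finally enters the base point. *)
Definition tsub (V : zmodType) (A B : {fset V}) : Prop :=
  exists u, forall x, x \in A -> u + x \in B.

Lemma tsub_trans (V : zmodType) (A B C : {fset V}) : tsub A B -> tsub B C -> tsub A C.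
Proof.
by move=> [u hu] [v hv]; exists (v + u) => x /hu/hv; rewrite addrA.
Qed.

Lemma tsub_addl (V : zmodType) (A B : {fset V}) : A != fset0 -> tsub B (A ⊕ B).
Proof. by move=> /fset0Pn[a aA]; exists a => x xB; exact: mem_addfs. Qed.

Lemma leq_card_tsub (V : zmodType) (A B : {fset V}) : tsub A B -> (#|` A| <= #|` B|)%N.
Proof.
move=> [u hu]; have <- : #|` [fset u + x | x in A]| = #|` A|.
  by rewrite card_imfset //; exact: addrI.
by apply: fsubset_leq_card; apply/fsubsetP => _ /imfsetP[x /= xA ->]; exact: hu.
Qed.

Lemma sumfs_neq0 (V : zmodType) (Xs : seq {fset V}) :
  (forall X, X \in Xs -> X != fset0) -> sumfs Xs != fset0.
Proof.
rewrite /sumfs; elim: Xs => [|X Xs IH] h.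
  by rewrite big_nil; apply/fset0Pn; exists 0; rewrite fset11.
rewrite big_cons; apply: addfs_neq0; first by apply: h; rewrite mem_head.
by apply: IH => Y YX; apply: h; rewrite inE YX orbT.
Qed.

(** Greedy: each new set is either paired off with a set of [Zs] with which it has a large sum, or
    has small sums with all of them and joins [Zs]. *)
Lemma matching (V : zmodType) (a : nat) (Xs : seq {fset V}) :
  exists Ys Zs : seq {fset V}, [/\ sumfs Xs = sumfs (Ys ++ Zs),
    (2 * size Ys + size Zs = size Xs)%N,
    forall Y, Y \in Ys -> (a <= #|` Y|)%N,
    {subset Zs <= Xs} &
    pairwise (fun A B : {fset V} => (#|` A ⊕ B| <= a)%N) Zs].
Proof.
rewrite /sumfs; elim: Xs => [|X Xs [Ys [Zs [sE szE hY sub pw]]]]; first by exists [::], [::].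
have [/hasP[Z ZZs aZ]|no] := boolP (has (fun Z => (a <= #|` X ⊕ Z|)%N) Zs).
  exists ((X ⊕ Z) :: Ys), (rem Z Zs); split.
  - rewrite big_cons sE cat_cons big_cons -addfsA; congr (_ ⊕ _).
    rewrite !big_cat /= (perm_big _ (perm_to_rem ZZs)) /= big_cons.
    by rewrite addfsA [_ ⊕ Z]addfsC -addfsA.
  - rewrite /= size_rem // -szE.
    have : (0 < size Zs)%N by rewrite lt0n size_eq0; apply: contraTneq ZZs => ->.
    by move: (size Zs) (size Ys); clear; lia.
  - by move=> Y; rewrite inE => /predU1P[-> //|/hY].
  - by move=> Y /mem_rem /sub YX; rewrite inE YX orbT.
  - exact: subseq_pairwise (rem_subseq _ _) pw.
exists Ys, (X :: Zs); split=> //.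
- by rewrite big_cons sE !big_cat /= big_cons !addfsA [X ⊕ _]addfsC.
- by rewrite /= -szE addnS.
- by move=> Y; rewrite !inE => /predU1P[->|/sub ->]; rewrite ?eqxx ?orbT.
- rewrite /= pw andbT; apply/allP => Z ZZs; rewrite leqNgt; apply/negP => lt.
  by move/hasPn: no => /(_ Z ZZs)/negP; apply; exact: ltnW.
Qed.

Lemma exists_fsubset_card (T : choiceType) (A : {fset T}) n : (n <= #|` A|)%N ->
  exists2 B : {fset T}, B `<=` A & #|` B| = n.
Proof.
move=> nA; exists [fset x in take n (enum_fset A)].
  by apply/fsubsetP => x; rewrite !inE => /mem_take.
rewrite card_fseq undup_id ?take_uniq ?fset_uniq // size_take.
by case: ltngtP nA.
Qed.

Lemma trim_family (V : zmodType) (n : nat) (Xs : seq {fset V}) :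
  (forall X, X \in Xs -> (n <= #|` X|)%N) ->
  exists Ys : seq {fset V}, [/\ size Ys = size Xs,
    forall Y, Y \in Ys -> #|` Y| = n & sumfs Ys `<=` sumfs Xs].
Proof.
rewrite /sumfs; elim: Xs => [|X Xs IH] h; first by exists [::]; rewrite !big_nil.
have [|Ys [sY hY sub]] := IH; first by move=> Y YX; apply: h; rewrite inE YX orbT.
have [B BX cB] := exists_fsubset_card (h X (mem_head _ _)).
exists (B :: Ys); split; first by rewrite /= sY.
  by move=> Y; rewrite inE => /predU1P[-> //|/hY].
by rewrite !big_cons addfsS.
Qed.

(* Either a quarter of the sets can be replaced by sums of pairs that are
   [4 ^ d.+1] times larger, in which case [s * (size Xs) ^ d.+1] does not
   decrease, or half of the sets have pairwise small sumsets. *)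
Lemma regular_family (V : zmodType) (d s : nat) (Xs : seq {fset V}) :
  (0 < s)%N -> (0 < size Xs)%N -> (forall X, X \in Xs -> #|` X| = s) ->
  exists (Zs : seq {fset V}) (s' : nat), [/\ (s <= s')%N,
    forall Z, Z \in Zs -> #|` Z| = s',
    pairwise (fun A B : {fset V} => (#|` A ⊕ B| <= 4 ^ d.+1 * s')%N) Zs,
    tsub (sumfs Zs) (sumfs Xs) &
    (size Zs <= size Xs)%N /\ (s * size Xs ^ d.+1 <= 2 ^ d.+1 * (s' * size Zs ^ d.+1))%N].
Proof.
have [n] := ubnP (size Xs); elim: n Xs s => // n IH Xs s /ltnSE sn s0 X0 hX.
have [Ys [Zs [sE szE hY sub pw]]] := matching (4 ^ d.+1 * s) Xs.
have nz (Us : seq {fset V}) k : (0 < k)%N -> (forall X, X \in Us -> (k <= #|` X|)%N) ->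
    forall X, X \in Us -> X != fset0.
  by move=> k0 h X /h le; rewrite -cardfs_gt0; exact: leq_trans le.
have K0 : (0 < 4 ^ d.+1 * s)%N by rewrite muln_gt0 expn_gt0.
have hZ Z : Z \in Zs -> #|` Z| = s by move=> /sub/hX.
have [big|small] := leqP (size Xs) (4 * size Ys).
  have [Ys' [sY' hY' subY]] := trim_family hY.
  have [||Us [s' [ss' hU pwU tU [sU cU]]]] := IH Ys' (4 ^ d.+1 * s)%N _ K0 _ hY'.
  - by rewrite sY'; lia.
  - by rewrite sY'; lia.
  exists Us, s'; split=> //.
  - by apply: leq_trans ss'; rewrite leq_pmull // expn_gt0.
  - apply: tsub_trans tU _; apply: (@tsub_trans _ _ (sumfs Ys)).
      by exists 0 => x xY; rewrite add0r; exact: (fsubsetP subY).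
    rewrite sE /sumfs big_cat /= addfsC; apply: tsub_addl; apply: sumfs_neq0.
    by apply: (nz Zs s s0) => Z /hZ ->.
  split; first by apply: leq_trans sU _; rewrite sY' -szE; lia.
  apply: leq_trans cU; rewrite sY' [(4 ^ _ * s)%N]mulnC -mulnA -expnMn leq_mul2l.
  by rewrite leq_expl ?orbT.
exists Zs, s; split=> //.
- rewrite sE /sumfs big_cat /=; apply: tsub_addl; apply: sumfs_neq0.
  exact: nz K0 hY.
split; first by rewrite -szE leq_addl.
rewrite mulnCA leq_mul2l -expnMn leq_expl ?orbT //; lia.
Qed.

(** * Sums of a regular family *)

(* [F] consists of the elements of [X] lying in [u - X'] for a popular sum [u];
   two of the translates [F + j x] with [j <= J] meet. *)
Lemma popular_step (V : zmodType) (K C s J : nat) (X X' W : {fset V}) :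
  (0 < s)%N -> #|` X| = s -> #|` X'| = s -> (#|` X ⊕ X'| <= K * s)%N ->
  (#|` X ⊕ W| <= C * s)%N -> (C * K <= J)%N ->
  exists2 u, u \in X ⊕ X' & forall x, (forall j, (j <= J)%N -> x *+ j \in W) ->
    exists2 q, (1 <= q <= J)%N & u + x *+ q \in X ⊕ X'.
Proof.
move=> s0 cX cX' hK hC hJ.
have XX0 : X `*` X' != fset0 by rewrite -cardfs_gt0 card_fsetM cX cX' muln_gt0 s0.
have [z|u _ hu] := @pigeonhole _ _ (X `*` X') (X ⊕ X') (fun z => z.1 + z.2) XX0.
  by rewrite !inE => /andP[zX zX']; exact: mem_addfs.
set G := [fset z in X `*` X' | z.1 + z.2 == u] in hu.
have GP z : z \in G -> [/\ z.1 \in X, z.2 \in X' & z.1 + z.2 = u].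
  by rewrite !inE => /andP[/andP[-> ->] /eqP].
pose F := [fset z.1 | z in G].
have cF : #|` F| = #|` G|.
  rewrite card_in_imfset //= => -[a b] [a' b'] /GP[_ _ /= e] /GP[_ _ /= e'] h.
  by move: e; rewrite h -e' => /addrI ->.
have FP f : f \in F -> f \in X /\ u - f \in X'.
  by move=> /imfsetP[z /= /GP[zX zX' <-] ->]; rewrite addrC addKr.
have sF : (s <= K * #|` F|)%N.
  rewrite -(leq_pmul2l s0); move: hu; rewrite card_fsetM cX cX' -cF => /leq_trans.
  by apply; rewrite mulnCA mulnA leq_mul2r hK orbT.
have F0 : (0 < #|` F|)%N.
  by rewrite lt0n; apply: contraTneq sF => ->; rewrite muln0 -ltnNge.
have [f fF] : exists f, f \in F by apply/fset0Pn; rewrite -cardfs_gt0.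
exists u.
  have [fX ufX] := FP f fF; rewrite -[u](subrK f) addrC; exact: mem_addfs.
move=> x hx; pose Q := F `*` [fset j in iota 0 J.+1].
pose g (z : V * nat) := z.1 + x *+ z.2.
have QP z : z \in Q -> z.1 \in F /\ (z.2 <= J)%N.
  rewrite in_fsetM => /andP[-> /imfsetP[j hj ->]]; split=> //.
  by have : j \in iota 0 J.+1 := hj; rewrite mem_iota.
have cQ : #|` Q| = (#|` F| * J.+1)%N.
  by rewrite card_fsetM card_fseq undup_id ?iota_uniq // size_iota.
have gQ : g @` Q `<=` X ⊕ W.
  apply/fsubsetP => _ /imfsetP[z /= /QP[zF zJ] ->].
  by apply: mem_addfs; [have [] := FP _ zF|exact: hx].
(* [F] has at least [s / K] elements, so disjoint translates would fill [(J + 1) |F| > C s] places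
   in [X + W]. *)
have ninj : ~ {in Q &, injective g}.
  move=> ginj; have := fsubset_leq_card gQ; rewrite card_in_imfset //= cQ.
  apply/negP; rewrite -ltnNge; apply: leq_ltn_trans hC _.
  have : (C * s <= C * (K * #|` F|))%N by rewrite leq_mul2l sF orbT.
  have : (C * K * #|` F| <= J * #|` F|)%N by rewrite leq_mul2r hJ orbT.
  by move: F0; rewrite mulnA mulnS [(#|` F| * J)%N]mulnC; clear; lia.
have [z [z' [zQ z'Q gzz lt]]] : exists z z', [/\ z \in Q, z' \in Q, g z = g z' & (z.2 < z'.2)%N].
  apply: contrapT => no; apply: ninj => z z' zQ z'Q e.
  have [lt|lt|eq2] := ltngtP z.2 z'.2.
  - by case: no; exists z, z'.
  - by case: no; exists z', z.
  - by move: e; rewrite /g eq2 => /addIr e1; rewrite (surjective_pairing z) e1 eq2 -surjective_pairing.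
have [zF zJ] := QP z zQ; have [z'F z'J] := QP z' z'Q.
exists (z'.2 - z.2)%N; first by move: lt z'J; clear; lia.
have -> : u + x *+ (z'.2 - z.2) = z.1 + (u - z'.1).
  have e : z.1 = z'.1 + x *+ (z'.2 - z.2).
    rewrite mulrnBr 1?ltnW // addrA -[z'.1 + _]/(g z') -gzz /g addrK //.
  by rewrite e [z'.1 + _]addrC -addrA [z'.1 + _]addrC subrK addrC.
by apply: mem_addfs; [have [] := FP _ zF|have [] := FP _ z'F].
Qed.

(** Among [J * J!] sets some value [q] serves at least [J!] of them. Letting [J! / q] of these
    contribute [u + q x] and all others [u] gives the sum of the [u] plus [J! x]; [q] depends on
    [x], the total translation does not. *)
Lemma common_multiple (V : zmodType) (J : nat) (Q : V -> Prop) (Bs : seq {fset V}) :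
  (0 < J)%N ->
  (forall B, B \in Bs -> exists2 u, u \in B & forall x, Q x ->
    exists2 q, (1 <= q <= J)%N & u + x *+ q \in B) ->
  (J * J`! <= size Bs)%N -> exists u, forall x, Q x -> u + x *+ J`! \in sumfs Bs.
Proof.
move=> J0 hB szB.
have /choice[u uP] : forall B : {fset V}, exists u, B \in Bs -> u \in B /\ forall x, Q x ->
    exists2 q, (1 <= q <= J)%N & u + x *+ q \in B.
  move=> B; have [/hB[u uB hu]|] := boolP (B \in Bs); last by exists 0.
  by exists u.
exists (\sum_(B <- Bs) u B) => x Qx.
have /choice[q qP] : forall B : {fset V}, exists q, B \in Bs ->
    (1 <= q <= J)%N /\ u B + x *+ q \in B.
  move=> B; have [BB|] := boolP (B \in Bs); last by exists 0%N.
  by have [_ /(_ x Qx)[q hq uq]] := uP B BB; exists q.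
have sel q0 n (Cs : seq {fset V}) : {subset Cs <= Bs} ->
    (n <= count (fun B => q B == q0) Cs)%N ->
    \sum_(B <- Cs) u B + x *+ (n * q0) \in sumfs Cs.
  rewrite /sumfs; elim: Cs n => [|B Cs IH] n sub.
    by rewrite leqn0 => /eqP ->; rewrite !big_nil mul0n mulr0n addr0 fset11.
  have BB : B \in Bs by apply: sub; rewrite mem_head.
  have subC : {subset Cs <= Bs} by move=> Y YC; apply: sub; rewrite inE YC orbT.
  rewrite /= !big_cons; case: n => [|n] hn.
    rewrite mul0n mulr0n addr0; apply: mem_addfs; first by have [] := uP B BB.
    by have := IH 0%N subC (leq0n _); rewrite mul0n mulr0n addr0.
  have [qB|qB] := eqVneq (q B) q0.
    rewrite qB eqxx add1n ltnS in hn.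
    rewrite mulSn mulrnDr addrACA; apply: mem_addfs; last exact: IH.
    by rewrite -qB; have [] := qP B BB.
  rewrite (negbTE qB) add0n in hn; rewrite -addrA; apply: mem_addfs; last exact: IH.
  by have [] := uP B BB.
have cnt : size Bs = (\sum_(i <- iota 1 J) count (fun B => q B == i) Bs)%N.
  have sub : {subset Bs <= Bs} by [].
  elim: {-2}Bs sub => [|B Cs IH] sub; first by rewrite /= big1.
  rewrite /= big_split /= -IH; last by move=> Y YC; apply: sub; rewrite inE YC orbT.
  rewrite -[in LHS]add1n; congr (_ + _)%N; rewrite -big_mkcond /= sum1_count.
  rewrite (eq_count (a2 := pred1 (q B))) => [|i]; last by rewrite /= eq_sym.
  rewrite count_uniq_mem ?iota_uniq // mem_iota.
  by have [h _] := qP B (sub B (mem_head _ _)); rewrite add1n ltnS h.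
have [i iJ hi] : exists2 i, i \in iota 1 J & (J`! <= count (fun B => q B == i) Bs)%N.
  apply: contrapT => no.
  have : (size Bs <= J * (J`!).-1)%N.
    rewrite cnt big_seq; apply: (@leq_trans (\sum_(i <- iota 1 J) (J`!).-1)).
      rewrite [leqRHS]big_seq; apply: leq_sum => i iJ.
      rewrite -ltnS prednK ?fact_gt0 // ltnNge; apply/negP => h; apply: no; by exists i.
    by rewrite big_const_seq count_predT iter_addn_0 size_iota mulnC.
  apply/negP; rewrite -ltnNge; apply: leq_trans szB.
  by rewrite ltn_pmul2l // prednK ?fact_gt0.
have [i0 iJ'] : (0 < i)%N /\ (i <= J)%N.
  by move: iJ; rewrite mem_iota add1n ltnS => /andP[].
have -> : J`! = (J`! %/ i * i)%N by rewrite divnK // dvdn_fact // i0.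
by apply: sel => //; apply: leq_trans hi; exact: leq_div.
Qed.

(** Points with nearby normalized coefficients have differences in the box shrunk by [J], whose
    multiples up to [J] remain in the original box, as [popular_step] requires. *)
Lemma gap_shrink r (p : 'I_r -> int) (m : 'I_r -> nat) (S : {fset int}) (J : nat) :
  (0 < J)%N -> S != fset0 -> (forall x, x \in S -> in_gap p m x) ->
  exists2 S' : {fset int}, (forall x, x \in S' -> in_gap p (fun i => m i %/ J)%N x) &
    (#|` S| <= (2 * J + 1) ^ r * #|` S'|)%N.
Proof.
move=> J0 S0 hS.
have /choice[k kP] : forall x, exists k : 'I_r -> int, x \in S ->
    (forall i, (`|k i| <= m i)%N) /\ x = \sum_i k i * p i.
  move=> x; have [xS|] := boolP (x \in S); last by exists (fun=> 0).
  by have [k h1 h2] := hS x xS; exists k.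
pose c x i : rat := (k x i)%:~R / (m i)%:R.
have c1 x : x \in S -> forall i, `|c x i| <= 1.
  move=> xS i; have [h _] := kP x xS; have [m0|m0] := posnP (m i).
    by rewrite /c m0 invr0 mulr0 normr0.
  rewrite /c normrM normfV normr_nat ler_pdivrMr ?ltr0n // mul1r -intr_norm.
  by rewrite pmulrn ler_int -abszE lez_nat.
have [F [FS cF hF]] := @cube_pigeonhole _ S r c J S0 c1.
have [x0 x0F] : exists x0, x0 \in F.
  apply/fset0Pn; apply: contraTneq cF => ->.
  by rewrite cardfs0 muln0 leqn0 cardfs_eq0.
exists [fset x - x0 | x in F]; last first.
  by rewrite card_imfset //; exact: addIr.
move=> _ /imfsetP[x /= xF ->].
have [h1 ->] := kP _ (fsubsetP FS _ xF); have [h2 ->] := kP _ (fsubsetP FS _ x0F).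
exists (fun i => k x i - k x0 i) => [i|]; last first.
  by rewrite -sumrB; apply: eq_bigr => i _; rewrite mulrBl.
rewrite leq_divRL //; have [m0|m0] := posnP (m i).
  by move: (h1 i) (h2 i); rewrite m0 => a b; rewrite (_ : k x i - k x0 i = 0) //; lia.
have := hF x x0 xF x0F i; rewrite /c -mulrBl normrM normfV normr_nat mulrAC.
rewrite ltr_pdivrMr ?ltr0n // mul1r -rmorphB -intr_norm !pmulrn -intrM ltr_int.
by rewrite -abszE -PoszM ltz_nat => /ltnW.
Qed.

Lemma gap_split r (p : 'I_r -> int) (m : 'I_r -> nat) (t : nat) x :
  in_gap p (fun i => t.+1 * m i)%N x ->
  exists y z, [/\ in_gap p (fun i => t * m i)%N y, in_gap p m z & x = y + z].
Proof.
move=> [k hk ->].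
have /choice[a ha] : forall i, exists a : int,
    (`|a| <= t * m i)%N /\ (`|(k i - a)%R| <= m i)%N.
  move=> i; have := hk i; rewrite mulSn => h.
  have [h1|h1] := leP (k i) (m i); last by exists (k i - (m i)%:Z); lia.
  have [h2|h2] := leP (- (m i)%:Z) (k i); first by exists 0; lia.
  by exists (k i + (m i)%:Z); lia.
exists (\sum_i a i * p i), (\sum_i (k i - a i) * p i); split.
- by exists a => // i; have [] := ha i.
- by exists (fun i => k i - a i) => // i; have [] := ha i.
- by rewrite -big_split; apply: eq_bigr => i _ /=; rewrite -mulrDl addrC subrK.
Qed.

(** Every block of [T] sets absorbs one copy of the box, and a point of the [t]-fold box is a sum of
    [t] points of the box. *)
Lemma blocks_gap r (p : 'I_r -> int) (m : 'I_r -> nat) (T : nat) (Rs : seq {fset int}) :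
  (forall X, X \in Rs -> X != fset0) ->
  (forall Xs, subseq Xs Rs -> size Xs = T ->
     exists u, forall x, in_gap p m x -> u + x \in sumfs Xs) ->
  forall t Xs, subseq Xs Rs -> (t * T <= size Xs)%N ->
     exists u, forall x, in_gap p (fun i => t * m i)%N x -> u + x \in sumfs Xs.
Proof.
move=> nz hT; elim=> [|t IH] Xs sub szX.
  have /fset0Pn[u uX] : sumfs Xs != fset0.
    by apply: sumfs_neq0 => X XX; apply: nz; exact: (mem_subseq sub).
  exists u => _ [k hk ->]; rewrite big1 ?addr0 // => i _.
  by have := hk i; rewrite mul0n leqn0 absz_eq0 => /eqP ->; rewrite mul0r.
rewrite mulSn in szX.
have [|u hu] := hT (take T Xs) (subseq_trans (take_subseq _ _) sub).
  by rewrite size_takel //; apply: leq_trans szX; exact: leq_addr.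
have [|v hv] := IH (drop T Xs) (subseq_trans (drop_subseq _ _) sub).
  by rewrite size_drop leq_subRL ?(leq_trans _ szX) ?leq_addr.
exists (v + u) => x /gap_split[y [z [hy hz ->]]].
rewrite -(cat_take_drop T Xs) /sumfs big_cat /= addfsC addrACA.
by apply: mem_addfs; [exact: hv|exact: hu].
Qed.

Lemma pair_up (V : zmodType) (e : rel {fset V}) n (Xs : seq {fset V}) :
  size Xs = (2 * n)%N -> pairwise e Xs ->
  exists Bs : seq {fset V}, [/\ size Bs = n, sumfs Bs = sumfs Xs &
    forall B, B \in Bs -> exists X X', [/\ X \in Xs, X' \in Xs, e X X' & B = X ⊕ X']].
Proof.
elim: n Xs => [|n IH] Xs szX pw.
  by exists [::]; rewrite (size0nil szX).
case: Xs szX pw => [|X [|X' Xs]] szX; try by move: szX; rewrite /=; lia.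
rewrite /= => /andP[/andP[eXX' _] /andP[_ pw]].
have [|Bs [szB sB hB]] := IH Xs _ pw; first by move: szX; rewrite /=; lia.
exists ((X ⊕ X') :: Bs); split; first by rewrite /= szB.
  by rewrite /sumfs !big_cons -/(sumfs Bs) sB addfsA.
move=> B; rewrite inE => /predU1P[->|/hB[Y [Y' [YX Y'X eYY ->]]]].
  by exists X, X'; rewrite !inE !eqxx ?orbT.
by exists Y, Y'; rewrite !inE YX Y'X !orbT.
Qed.

(** The first two sets are spent on producing the GAP; the others, in blocks of [T], contain
    translates of its shrunken [J!]-fold dilate, to which [gap_dichotomy] applies. *)
Lemma family_dichotomy (R : realType) (d K : nat) : (0 < d)%N ->
  exists C s0 : nat, forall (s : nat) (Zs : seq {fset int}),
    (s0 <= s)%N -> (0 < size Zs)%N -> (forall Z, Z \in Zs -> #|` Z| = s) ->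
    pairwise (fun A B : {fset int} => (#|` A ⊕ B| <= K * s)%N) Zs ->
    (size Zs ^ d.+1 * s <= C * #|` sumfs Zs|)%N \/
    (exists (y u : int) (L : nat), [/\ y != 0,
       forall j : nat, (j <= L)%N -> u + j%:Z * y \in sumfs Zs &
       (size Zs ^ d * s <= C * L ^ d)%N]).
Proof.
(* With [V = 2Y - 2Y], the triangle inequality through [Y] gives [|X + V| <= K^7 s], from
   [|X + Y| <= K s] and [|Y + V| <= |3Y - 3Y| <= K^6 s]; hence [J]. A block has [J * J!] pairs,
   hence [T]. The threshold on [s] makes the shrunken GAP exceed [3 ^ d] points. *)
move=> d0; pose J := (K ^ 7 * K + 1)%N; pose T := (2 * (J * J`!))%N.
pose fr := freiman_freq K; pose D := fr.+1; pose E := (24 * (D + 1) ^ 2)%N.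
pose G := (96 * (D + 1) ^ 2)%N; pose C3 := (bohr_const fr * (2 * J + 1) ^ D)%N.
pose M0 := (T * E + 2)%N.
exists (M0 ^ d.+1 + (4 * T) ^ d.+1 * C3 * G ^ d.+1)%N, (C3 * 3 ^ d + 1)%N.
move=> s Zs sbig M1 hZ pw.
have s1 : (0 < s)%N by apply: leq_trans sbig; rewrite addn1.
have nz Z : Z \in Zs -> Z != fset0 by move=> /hZ cZ; rewrite -cardfs_gt0 cZ.
have J0 : (0 < J)%N by rewrite /J addn1.
have T2 : (2 <= T)%N by rewrite /T leq_pmulr // muln_gt0 J0 fact_gt0.
have s_sum : (s <= #|` sumfs Zs|)%N.
  case: Zs M1 hZ nz {pw} => // Z Zs _ hZ nz; rewrite /sumfs big_cons -(hZ Z (mem_head _ _)).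
  by apply: leq_card_addfsl; apply: sumfs_neq0 => X XZ; apply: nz; rewrite inE XZ orbT.
(* For boundedly many sets the lower bound [s] on the sumset already gives the first alternative. *)
have [Msmall|Mbig] := ltnP (size Zs) M0.
  left; apply: (@leq_trans (M0 ^ d.+1 * s)).
    by rewrite leq_mul2r leq_expl ?orbT // ltnW.
  by apply: leq_mul => //; exact: leq_addr.
case: Zs M1 hZ pw nz s_sum Mbig => [|Y [|Z Rs]] // _ hZ pw nz s_sum; rewrite /M0 /= => Mbig.
  by move: Mbig; rewrite addn2.
have cY : #|` Y| = s by rewrite hZ ?mem_head.
have cZ : #|` Z| = #|` Y| by rewrite cY hZ // !inE eqxx orbT.
have Y0 : Y != fset0 by rewrite nz ?mem_head.
move: pw; rewrite /= => /andP[/andP[YZ /allP YR] /andP[_ pwR]].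
have hZY : (#|` Z ⊕ Y| <= K * #|` Y|)%N by rewrite addfsC cY.
have Z0 : Z != fset0 by rewrite -cardfs_gt0 cZ cardfs_gt0.
have [r [p [m [S [rD gapV Sgap cS]]]]] := freiman_gap R Y0 cZ hZY.
set V := mulfs Y 2 ⊕ ⊖ mulfs Y 2 in gapV.
have XV X : X \in Rs -> (#|` X ⊕ V| <= K ^ 7 * s)%N.
  move=> XR; rewrite -(leq_pmul2r s1) -{1}cY.
  apply: leq_trans (ruzsa_triangle X Y V) _.
  have -> : ⊖ V = V by rewrite /V oppfsD oppfsK addfsC.
  have hYV : (#|` Y ⊕ V| <= K ^ 6 * s)%N.
    have := card_mulfs_sub 3 Z0 (_ : #|` Z ⊕ Y| <= K * #|` Z|)%N; rewrite cZ => /(_ hZY).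
    rewrite cY; apply: leq_trans.
    have gen (A : {fset int}) : A ⊕ Y ⊕ ⊖ (A ⊕ Y) = Y ⊕ (A ⊕ ⊖ A) ⊕ ⊖ Y.
      by rewrite oppfsD !addfsA [A ⊕ Y]addfsC.
    rewrite -[mulfs Y 3]/(mulfs Y 2 ⊕ Y) gen.
    exact: leq_card_addfsl (oppfs_neq0 Y0).
  have hXY : (#|` X ⊕ Y| <= K * s)%N by rewrite addfsC; exact: YR.
  apply: leq_trans (leq_mul hXY hYV) _.
  by rewrite mulnACA -expnS mulnA.
have S0 : S != fset0.
  rewrite -cardfs_gt0 lt0n; apply: contraTneq cS => ->.
  by rewrite muln0 -ltnNge cY.
have [S1 S1gap cS1] := gap_shrink J0 S0 Sgap.
have sS1 : (s <= C3 * #|` S1|)%N.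
  rewrite -cY; apply: leq_trans cS _; rewrite /C3 -mulnA leq_mul2l; apply/orP; right.
  by apply: leq_trans cS1 _; rewrite leq_mul2r leq_pexp2l ?orbT // addn1.
pose p' i := p i * J`!%:Z; pose m' i := (m i %/ J)%N.
have gap_p' x : in_gap p m' x -> in_gap p' m' (x * J`!%:Z).
  move=> [k hk ->]; exists k => //; rewrite mulr_suml.
  by apply: eq_bigr => i _; rewrite mulrA.
pose S2 := [fset x * J`!%:Z | x in S1].
have cS2 : #|` S2| = #|` S1|.
  rewrite card_imfset // => x y; apply: mulIf.
  by rewrite eqz_nat -lt0n fact_gt0.
have S2gap x : x \in S2 -> in_gap p' m' x by move=> /imfsetP[y /= /S1gap/gap_p' h ->].
have block Xs : subseq Xs Rs -> size Xs = T ->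
    exists u, forall x, in_gap p' m' x -> u + x \in sumfs Xs.
  move=> sub szX; have subm := mem_subseq sub.
  have [Bs [szB sB hB]] := pair_up szX (subseq_pairwise sub pwR).
  have [||u hu] := @common_multiple _ J (in_gap p m') Bs J0; last first.
  - exists u => _ [k hk ->].
    have := hu (\sum_i k i * p i); rewrite sB -mulr_natr natz => /(_ _)/wrap[|].
      by exists k.
    by rewrite mulr_suml; under eq_bigr do rewrite -mulrA.
  - by rewrite szB.
  move=> B /hB[X [X' [/subm XR /subm X'R XX' ->]]].
  have inZ W : W \in Rs -> W \in Y :: Z :: Rs by move=> WR; rewrite !inE WR !orbT.
  have [|u uX hu] := popular_step s1 (hZ X (inZ X XR)) (hZ X' (inZ X' X'R)) XX' (XV X XR) (_ : _ <= J)%N.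
    by rewrite /J leq_addr.
  exists u => // x [k hk ->]; apply: hu => j jJ; apply: gapV.
  exists (fun i => k i *+ j) => [i|].
    rewrite -mulr_natr natz abszM /=; apply: (@leq_trans (m' i * J)); first exact: leq_mul.
    exact: leq_trunc_div.
  by rewrite -sumrMnl; apply: eq_bigr => i _; rewrite mulrnAl.
pose t := (size Rs %/ T)%N.
have Tpos : (0 < T)%N by apply: leq_trans T2.
have szR : (T * E <= size Rs)%N by move: Mbig; rewrite addn2 !ltnS.
have tE : (E <= t)%N by rewrite leq_divRL // mulnC.
have t1 : (0 < t)%N by apply: leq_trans tE; rewrite /E muln_gt0 expn_gt0 addn1.
have Mt : ((size Rs).+2 <= 4 * T * t)%N.
  have := ltn_ceil (size Rs) Tpos; rewrite -/t => h.
  have : (T <= t * T)%N by rewrite leq_pmull.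
  by move: h T2; rewrite mulSn -mulnA [(T * t)%N]mulnC; clear; lia.
have [|u hu] := blocks_gap _ block (subseq_refl Rs) (leq_trunc_div _ _ : (t * T <= size Rs)%N).
  by move=> X XR; apply: nz; rewrite !inE XR !orbT.
have RZ : tsub (sumfs Rs) (sumfs (Y :: Z :: Rs)).
  rewrite /sumfs !big_cons addfsA; apply: tsub_addl; exact: addfs_neq0.
have S2large : (3 ^ d < #|` S2|)%N.
  rewrite ltnNge cS2; apply/negP => h; have := leq_trans sbig sS1.
  by apply/negP; rewrite -ltnNge addn1 ltnS leq_mul2l h orbT.
have bound k (B : nat) : (k <= d.+1)%N -> (t ^ k * #|` S2| <= G ^ k * B)%N ->
    ((size Rs).+2 ^ k * s <= (M0 ^ d.+1 + (4 * T) ^ d.+1 * C3 * G ^ d.+1) * B)%N.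
  move=> kd hB; apply: (@leq_trans ((4 * T * t) ^ k * (C3 * #|` S2|))).
    by rewrite cS2; apply: leq_mul => //; exact: leq_expl.
  rewrite expnMn mulnACA; apply: (@leq_trans ((4 * T) ^ k * C3 * (G ^ k * B))).
    by rewrite leq_mul2l hB orbT.
  rewrite mulnA leq_mul2r; apply/orP; right; apply: leq_trans (leq_addl _ _).
  have le1 : ((4 * T) ^ k <= (4 * T) ^ d.+1)%N by rewrite leq_pexp2l // muln_gt0.
  have le2 : (G ^ k <= G ^ d.+1)%N by rewrite leq_pexp2l // /G muln_gt0 expn_gt0 addn1.
  by rewrite leq_mul // leq_mul.
have [[S' S'gap cS']|[y [L [y0 yL] cL]]] := gap_dichotomy rD d0 tE S2large S2gap.
  left; apply: leq_trans (bound d.+1 _ (leqnn _) cS') _.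
  rewrite leq_mul2l; apply/orP; right; apply: leq_card_tsub; apply: tsub_trans RZ.
  by exists u => x /S'gap/hu.
right; have [v hv] := RZ; exists y, (v + u), L; split=> //.
  by move=> j /yL/hu/hv; rewrite addrA.
exact: bound cL.
Qed.

(** * Long progressions *)

(** Otherwise [A + B = A + b] for [b] in [B], and [A] would be stable under the nonzero translation
    [b' - b], impossible for a finite set of integers. *)
Lemma ltn_card_addfs (A B : {fset int}) :
  A != fset0 -> (1 < #|` B|)%N -> (#|` A| < #|` A ⊕ B|)%N.
Proof.
move=> A0 B1; rewrite ltnNge; apply/negP => le.
have [b bB] : exists b, b \in B by apply/fset0Pn; rewrite -cardfs_gt0 ltnW.
have [b' b'B bb'] : exists2 b', b' \in B & b' != b.
  have /fset0Pn[b' ] : B `\ b != fset0.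
    by rewrite -cardfs_gt0; move: B1; rewrite (cardfsD1 b) bB.
  by rewrite !inE => /andP[h b'B]; exists b'.
have full : A ⊕ [fset b] = A ⊕ B.
  apply/eqP; rewrite eqEfcard card_addfs1 le andbT.
  by apply: addfsS => //; rewrite fsub1set.
have shift x : x \in A -> x + (b' - b) \in A.
  move=> xA; have : x + b' \in A ⊕ [fset b] by rewrite full mem_addfs.
  by move=> /addfsP[y [z [yA /fset1P -> e]]]; rewrite addrA e addrK.
have [a aA] := fset0Pn _ A0.
have iterA n : a + (b' - b) *+ n \in A.
  by elim: n => [|n IH]; rewrite ?mulr0n ?addr0 // mulrSr addrA shift.
pose f (n : nat) := a + (b' - b) *+ n.
have finj : injective f.
  by move=> n n' /addrI; apply: mulrIn; rewrite subr_eq0.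
pose I := [fset j in iota 0 #|` A|.+1].
have : (#|` f @` I| <= #|` A|)%N.
  by apply: fsubset_leq_card; apply/fsubsetP => _ /imfsetP[n _ ->]; exact: iterA.
by rewrite card_imfset //= card_fseq undup_id ?iota_uniq // size_iota ltnn.
Qed.

(** Each further summand with at least two elements enlarges a sum by at least one, so a block of
    [g] sets exceeds [g] elements however small [k] is. *)
Lemma grouping (k g q : nat) (Xs : seq {fset int}) : (1 < k)%N -> (0 < g)%N ->
  (forall X, X \in Xs -> #|` X| = k) -> (q * g <= size Xs)%N ->
  exists Ys : seq {fset int}, [/\ size Ys = q,
    forall Y, Y \in Ys -> (maxn g k <= #|` Y|)%N & tsub (sumfs Ys) (sumfs Xs)].
Proof.
move=> k1 g0; have k0 := ltnW k1.
have big (Us : seq {fset int}) : (forall X, X \in Us -> #|` X| = k) -> (0 < size Us)%N ->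
    (maxn (size Us).+1 k <= #|` sumfs Us|)%N.
  elim: Us => // U Us IH hU _; rewrite /sumfs big_cons -/(sumfs Us).
  have cU : #|` U| = k by rewrite hU ?mem_head.
  have U0 : U != fset0 by rewrite -cardfs_gt0 cU.
  have hUs X : X \in Us -> #|` X| = k by move=> XU; rewrite hU // inE XU orbT.
  have Us0 : sumfs Us != fset0.
    by apply: sumfs_neq0 => X /hUs cX; rewrite -cardfs_gt0 cX.
  rewrite geq_max; apply/andP; split; last by rewrite -{1}cU leq_card_addfsl.
  rewrite addfsC; apply: leq_trans (ltn_card_addfs Us0 _); last by rewrite cU.
  rewrite ltnS /=; case: Us IH {hU} hUs Us0 => [_ _ h|U' Us IH hUs _].
    by rewrite cardfs_gt0.
  by have := IH hUs isT; rewrite geq_max => /andP[].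
elim: q Xs => [|q IH] Xs hX szX.
  exists [::]; split=> //; have /fset0Pn[u uX] : sumfs Xs != fset0.
    by apply: sumfs_neq0 => X /hX cX; rewrite -cardfs_gt0 cX.
  by exists u => x; rewrite /sumfs big_nil => /fset1P ->; rewrite addr0.
rewrite mulSn in szX.
have hd X : X \in drop g Xs -> #|` X| = k by move=> /mem_drop/hX.
have ht X : X \in take g Xs -> #|` X| = k by move=> /mem_take/hX.
have st : size (take g Xs) = g by rewrite size_takel // (leq_trans _ szX) ?leq_addr.
have [|Ys [szY hY [u hu]]] := IH (drop g Xs) hd.
  by rewrite size_drop leq_subRL ?(leq_trans _ szX) ?leq_addr.
exists (sumfs (take g Xs) :: Ys); split; first by rewrite /= szY.
  move=> Y; rewrite inE => /predU1P[->|/hY //].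
  have := big _ ht; rewrite st => /(_ g0); apply: leq_trans.
  by rewrite !geq_max leq_maxr andbT leq_max leqnSn.
exists u => x; rewrite -[Xs in X in _ -> X](cat_take_drop g Xs) /sumfs big_cons big_cat /=.
move=> /addfsP[y [z [hy hz ->]]]; rewrite addrCA; apply: mem_addfs => //; exact: hu.
Qed.

Lemma mem_sumfs_fam (I : eqType) (A : I -> {fset int}) (s : seq I) x : uniq s ->
  x \in sumfs [seq A i | i <- s] ->
  exists a : I -> int, (forall i, i \in s -> a i \in A i) /\ x = \sum_(i <- s) a i.
Proof.
rewrite /sumfs; elim: s x => [|i s IH] x /=.
  by rewrite !big_nil => _ /fset1P ->; exists (fun=> 0); rewrite big_nil.
rewrite big_cons => /andP[is_ us] /addfsP[y [z [yA /(IH _ us)[a [aA ->]] ->]]].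
exists (fun j => if j == i then y else a j); split.
  move=> j; rewrite inE; case: eqP => [-> _ //|_ /=]; exact: aA.
rewrite big_cons eqxx; congr (_ + _); rewrite !big_seq; apply: eq_bigr => j js.
by case: eqP => // ji; rewrite -ji js in is_.
Qed.

Lemma leq_mulsum_int (l n : nat) (a : 'I_l -> int) :
  (forall i, (1 <= a i) && (a i <= n%:Z)) -> l%:Z <= \sum_i a i <= (l * n)%N%:Z.
Proof.
move=> h; apply/andP; split.
  have -> : l%:Z = \sum_(i < l) 1 by rewrite sumr_const card_ord -natz.
  by apply: ler_sum => i _; have /andP[] := h i.
have -> : (l * n)%N%:Z = \sum_(i < l) n%:Z.
  by rewrite sumr_const card_ord -mulr_natl natz PoszM.
by apply: ler_sum => i _; have /andP[] := h i.
Qed.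

Local Open Scope classical_set_scope.
Local Open Scope ring_scope.

Lemma sumset_progression (R : realType) (d : nat) : (0 < d)%N ->
  exists C0 B : nat, [/\ (0 < C0)%N, (0 < B)%N & forall (n l k : nat) (A : 'I_l -> {fset int}),
    (0 < n)%N -> (1 < k)%N ->
    (forall (i : 'I_l) (x : int), x \in A i -> (1 <= x) && (x <= n%:Z)) ->
    (forall i : 'I_l, #|` A i|%fset = k) ->
    (C0 * n <= l ^ d * k)%N ->
    exists (y u : int) (L : nat), [/\ y != 0, (d <= L)%N,
      forall j : nat, (j <= L)%N -> sumset A (u + j%:Z * y) &
      (l ^ d * k <= B * L ^ d)%N]].
Proof.
move=> d0; have [C [s0 hfam]] := @family_dichotomy R d (4 ^ d.+1) d0.
(* In [Q] the factors stand for the losses in grouping, in [regular_family] and in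
   [family_dichotomy]. In the constant for [n], [Q * d ^ d] forces [d <= L], [Q] excludes the large
   sumset, [g ^ d] forces [g <= l], and 1 makes the inequalities strict. *)
pose g := s0.+1; pose Q := ((2 * g) ^ d.+1 * 2 ^ d.+1 * C)%N.
exists (Q * d ^ d + Q + g ^ d + 1)%N, (Q + 1)%N; split; rewrite ?addn1 //.
move=> n l k A n0 k1 An cA hC.
have hC' a : (a <= Q * d ^ d + Q + g ^ d)%N -> (a * n < l ^ d * k)%N.
  by move=> ha; apply: leq_trans hC; rewrite ltn_pmul2r // ltnS.
have l0 : (0 < l)%N.
  rewrite lt0n; apply/negP => /eqP l0; have := hC' 0%N (leq0n _).
  by rewrite l0 exp0n.
have kn : (k <= n)%N.
  rewrite -(cA (Ordinal l0)) -(card_int_range n).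
  have <- : #|` [fset x - 1 | x in A (Ordinal l0)]| = #|` A (Ordinal l0)|.
    by rewrite card_imfset //; exact: addIr.
  apply: fsubset_leq_card; apply/fsubsetP => _ /imfsetP[x /= /An hx ->].
  by rewrite mem_int_range; lia.
have gl : (g <= l)%N.
  rewrite leqNgt; apply/negP => lg; have := hC' (g ^ d)%N (leq_addl _ _).
  apply/negP; rewrite -leqNgt; apply: leq_mul => //; apply: leq_expl; exact: ltnW.
pose Xs := [seq A i | i <- enum 'I_l].
have szX : size Xs = l by rewrite size_map size_enum_ord.
have hX X : X \in Xs -> #|` X| = k by move=> /mapP[i _ ->].
have sumX x : x \in sumfs Xs -> sumset A x.
  move=> /(mem_sumfs_fam (enum_uniq _))[a [aA ->]]; exists a; split.
    by move=> i; apply: aA; rewrite mem_enum.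
  by rewrite big_enum.
pose q := (l %/ g)%N; have q0 : (0 < q)%N by rewrite divn_gt0.
have lq : (l <= 2 * g * q)%N.
  have := ltn_ceil l (ltn0Sn s0); rewrite -/g -/q.
  have : (g <= g * q)%N by rewrite leq_pmulr.
  by rewrite mulSn -mulnA [(q * g)%N]mulnC; clear; lia.
have [|Ys [szY hY tY]] := @grouping k g q Xs k1 (ltn0Sn _) hX.
  by rewrite szX leq_trunc_div.
pose s := maxn g k; have s_pos : (0 < s)%N by rewrite leq_max.
have [Us [szU hU subU]] := trim_family hY.
have U0 : (0 < size Us)%N by rewrite szU szY.
have [Zs [s' [ss' hZ pwZ tZ [szZ cZ]]]] := regular_family d s_pos U0 hU.
rewrite szU szY in szZ cZ.
have tZX : tsub (sumfs Zs) (sumfs Xs).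
  apply: tsub_trans tZ (tsub_trans _ tY); exists 0 => x xU; rewrite add0r.
  exact: (fsubsetP subU).
have Z0 : (0 < size Zs)%N.
  rewrite lt0n; apply: contraTneq cZ => ->.
  by rewrite exp0n // !muln0 -ltnNge muln_gt0 s_pos expn_gt0 q0.
have s0s' : (s0 <= s')%N by apply: leq_trans ss'; rewrite leq_max ltnW.
have ks : (k <= s)%N by rewrite leq_maxr.
have [large|[y [u [L [y0 yL cL]]]]] := hfam s' Zs s0s' Z0 hZ pwZ.
  (* All sums lie in [[1, l n]], while the alternative at hand would give [l^(d+1) k <= Q l n]. *)
  have cX : (#|` sumfs Xs| <= l * n)%N.
    rewrite -(card_int_range (l * n)).
    have <- : #|` [fset x - 1 | x in sumfs Xs]| = #|` sumfs Xs|.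
      by rewrite card_imfset //; exact: addIr.
    apply: fsubset_leq_card; apply/fsubsetP => _ /imfsetP[x /= /sumX[a [aA ->]] ->].
    have := leq_mulsum_int (fun i => An i _ (aA i)); rewrite mem_int_range.
    by move: (\sum_i _) l0 => z; clear; lia.
  exfalso; have := hC' Q (leq_trans (leq_addl _ _) (leq_addr _ _)).
  apply/negP; rewrite -leqNgt -(leq_pmul2l l0) mulnA -expnS.
  apply: (@leq_trans ((2 * g) ^ d.+1 * (s * q ^ d.+1))).
    by rewrite mulnCA -expnMn mulnC leq_mul // leq_expl.
  rewrite [(l * _)%N]mulnCA /Q -!mulnA leq_mul2l; apply/orP; right.
  apply: leq_trans cZ _; rewrite leq_mul2l; apply/orP; right.
  rewrite mulnC; apply: leq_trans large _; rewrite leq_mul2l.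
  by rewrite (leq_trans (leq_card_tsub tZX) cX) orbT.
have main : (l ^ d * k <= Q * L ^ d)%N.
  (* One factor is cancelled here: [size Zs <= q] turns the exponent [d + 1] into [d]. *)
  have h1 : (s * q ^ d <= 2 ^ d.+1 * (size Zs ^ d * s'))%N.
    rewrite -(leq_pmul2r q0) -mulnA -expnSr; apply: leq_trans cZ _.
    rewrite -mulnA leq_mul2l; apply/orP; right.
    by rewrite expnSr mulnCA mulnA leq_mul // mulnC.
  apply: (@leq_trans ((2 * g) ^ d * (s * q ^ d))).
    by rewrite mulnCA -expnMn mulnC leq_mul // leq_expl.
  rewrite /Q -!mulnA; apply: leq_mul; first by rewrite leq_pexp2l.
  by apply: leq_trans h1 _; rewrite leq_mul2l cL orbT.
have [v hv] := tZX; exists y, (v + u), L; split=> //.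
- rewrite leqNgt; apply/negP => Ld; have := hC' (Q * d ^ d)%N (leq_trans (leq_addr _ _) (leq_addr _ _)).
  move=> /leq_trans/(_ main); apply/negP; rewrite -leqNgt.
  apply: (@leq_trans (Q * d ^ d)); last by rewrite leq_pmulr.
  by rewrite leq_mul2l leq_expl ?orbT // ltnW.
- by move=> j /yL/hv/sumX; rewrite addrA.
- by apply: leq_trans main _; rewrite leq_mul2r leqnSn orbT.
Qed.

(* For |A| = 1 the sumset is one point, and only a GAP with a zero step can have
   positive volume there; hence the guard (1 < k) on nondegeneracy. *)
Theorem theorem5p1 (R : realType) (d : nat) (hd : (0 < d)%N) :
  exists C c : R, [/\ 0 < C, 0 < c &
    forall (n l k : nat) (A : 'I_l -> {fset int}),
      (0 < n)%N ->
      (forall (i : 'I_l) (x : int), x \in A i -> (1 <= x) && (x <= n%:Z)) ->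
      (forall i : 'I_l, #|` A i|%fset = k) ->
      C * n%:R <= l%:R ^+ d * k%:R ->
      exists (d' : nat) (Q : gap d'),
        [/\ (1 <= d' <= d)%N,
            gap_set Q `<=` sumset A,
            c * l%:R ^+ d' * k%:R <= (gap_volume Q)%:R
          & (1 < k)%N -> gap_nondegenerate Q]].
Proof.
have [C0 [B [C0pos Bpos hprog]]] := sumset_progression R hd.
(* From [d <= L] follows [L <= 2 * d * (L %/ d)], which bounds the loss of splitting the length into
   [d] equal parts. *)
pose E := (B * (2 * d) ^ d)%N.
have E0 : (0 < E)%N by rewrite muln_gt0 Bpos expn_gt0 muln_gt0 hd.
exists C0%:R, E%:R^-1; split; rewrite ?invr_gt0 ?ltr0n //.
move=> n l k A n0 An cA; rewrite -natrX -!natrM ler_nat => hC.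
have [k1|k1] := leqP k 1.
  have k0 : (0 < k)%N.
    by rewrite lt0n; apply: contraTneq hC => ->; rewrite muln0 -ltnNge muln_gt0 C0pos.
  have /choice[a aA] : forall i, exists x, x \in A i.
    by move=> i; apply/fset0Pn; rewrite -cardfs_gt0 cA.
  exists 1%N, (@Gap 1 (\sum_i a i) (fun=> 0) (fun=> l)); split=> //.
  - move=> _ [x [_ ->]] /=; exists a; split=> //.
    by rewrite [X in _ + X]big1 ?addr0 // => i _; rewrite mulr0.
  - have -> : k = 1%N by apply/eqP; rewrite eqn_leq k1.
    rewrite /gap_volume big_ord1 /= expr1 mulr1 ler_piMl //.
    by rewrite invf_le1 ?ltr0n // ler1n.
have [y [u [L [y0 dL hL cL]]]] := hprog n l k A n0 k1 An cA hC.
(* The coordinates add up to at most [d * (L %/ d) <= L], so every point is a term of the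
   progression; the rank obtained is [d] itself. *)
exists d, (@Gap d u (fun=> y) (fun=> (L %/ d)%N)); split; rewrite ?hd ?leqnn //.
- move=> _ [x [/= hx ->]].
  have -> : u + \sum_(i < d) (x i)%:Z * y = u + (\sum_(i < d) x i)%N%:Z * y.
    by rewrite -mulr_suml (big_morph Posz PoszD (erefl 0%N%:Z)).
  apply: hL; apply: leq_trans (leq_trunc_div L d).
  apply: (@leq_trans (\sum_(i < d) L %/ d)%N); first exact: leq_sum.
  by rewrite sum_nat_const card_ord mulnC.
- rewrite /gap_volume prod_nat_const card_ord -mulrA mulrC ler_pdivrMr ?ltr0n //.
  rewrite -natrX -!natrM ler_nat; apply: leq_trans cL _.
  rewrite /E mulnCA leq_mul2l mulnC -expnMn; apply/orP; right; apply: leq_expl.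
  have := ltn_ceil L hd; have : (1 <= L %/ d)%N by rewrite divn_gt0.
  by move: (L %/ d)%N => w; clear; nia.
- by move=> _ i.
Qed.
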